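(* Fix $\delta t>0$. In the limit $\epsilon\to0$ with $\epsilon\,\nu_\epsilon\to\bar\nu\in(0,\infty)$, the numerical flow $\Phi^{\nu_\epsilon}_{\delta t}$ associated with the leapfrog/Verlet integrator with constraints for the Hamiltonian $$H_{\mathrm{IMMP}}(q,z,p,p_z)=\tfrac12p^TM^{-1}p+\tfrac12p_z^TM_z^{-1}p_z+U\Big(q,\frac z{\nu_\epsilon\epsilon}\Big)+V_{\mathrm{fix},\nu_\epsilon}(q),\qquad\xi(q)=\frac z{\nu_\epsilon},$$ converges towards the numerical flow $\Phi^{\bar\nu}_{\delta t}$, which is the leapfrog/Verlet integrator with geometric constraints associated with the effective Hamiltonian on the slow manifold $$H_{\mathrm{eff},\bar\nu}(q,z,p,p_z)=\tfrac12p^TM^{-1}p+\tfrac12p_z^TM_z^{-1}p_z+U\Big(q,\frac z{\bar\nu}\Big)+V_{\mathrm{fix}}(q),\qquad\xi(q)=0 .$$ That is, locally (where the implicit constraint equations are well-posed), if admissible states $x_\epsilon$ for the first integrator converge to an admissible state $x_0$ for the second one, then $\Phi^{\nu_\epsilon}_{\delta t}(x_\epsilon)\to\Phi^{\bar\nu}_{\delta t}(x_0)$.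
   Context: $M$ ($d\times d$), $M_z$ ($n\times n$) are symmetric positive definite, $\beta>0$. $\xi:\mathbb{R}^d\to\mathbb{R}^n$ is smooth with non-degenerate Jacobian near $\mathcal{M}_0=\{\xi(q)=0\}$ (the slow manifold); $(\nabla_q\xi)_{ji}=\partial\xi_i/\partial q_j$. $U:\mathbb{R}^d\times\mathbb{R}^n\to\mathbb{R}$ is smooth; $\nabla_1U,\nabla_2U$ denote gradients in the first and second variables. $M_\nu=M+\nu^2\nabla_q\xi M_z\nabla_q^T\xi$, $V_{\mathrm{fix},\nu}=\frac1{2\beta}\ln\det M_\nu$, $G=\nabla_q^T\xi M^{-1}\nabla_q\xi$, $V_{\mathrm{fix}}=\frac1{2\beta}\ln\det G$. Both integrators have the form, with $a>0$, a potential $W(q)$ and a number $b\ge0$: with Lagrange multipliers $\lambda_{n+1/2},\lambda_{n+1}\in\mathbb{R}^n$, $p_{n+1/2}=p_n-\frac{\delta t}2\big(\nabla_1U(q_n,\frac{z_n}a)+\nabla_qW(q_n)\big)-\nabla_q\xi(q_n)\lambda_{n+1/2}$, $\ p^z_{n+1/2}=p^z_n-\frac{\delta t}{2a}\nabla_2U(q_n,\frac{z_n}a)+b\lambda_{n+1/2}$; $q_{n+1}=q_n+\delta t\,M^{-1}p_{n+1/2}$, $\ z_{n+1}=z_n+\delta t\,M_z^{-1}p^z_{n+1/2}$, with $\xi(q_{n+1})=b\,z_{n+1}$; $p_{n+1}=p_{n+1/2}-\frac{\delta t}2\big(\nabla_1U(q_{n+1},\frac{z_{n+1}}a)+\nabla_qW(q_{n+1})\big)-\nabla_q\xi(q_{n+1})\lambda_{n+1}$,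 $\ p^z_{n+1}=p^z_{n+1/2}-\frac{\delta t}{2a}\nabla_2U(q_{n+1},\frac{z_{n+1}}a)+b\lambda_{n+1}$, with $\nabla_q^T\xi(q_{n+1})M^{-1}p_{n+1}=b\,M_z^{-1}p^z_{n+1}$. $\Phi^{\nu_\epsilon}_{\delta t}$ is the one-step map $(q_n,z_n,p_n,p^z_n)\mapsto(q_{n+1},z_{n+1},p_{n+1},p^z_{n+1})$ for $a=\nu_\epsilon\epsilon$, $b=1/\nu_\epsilon$, $W=V_{\mathrm{fix},\nu_\epsilon}$; $\Phi^{\bar\nu}_{\delta t}$ is the one for $a=\bar\nu$, $b=0$, $W=V_{\mathrm{fix}}$. A state $(q,z,p,p^z)$ is admissible if $\xi(q)=bz$ and $\nabla_q^T\xi(q)M^{-1}p=b\,M_z^{-1}p^z$. *)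

(* Defs.v *)
From HB Require Import structures.
From mathcomp Require Import all_boot all_order all_algebra.
From mathcomp Require Import all_classical all_reals all_analysis.
Set Implicit Arguments.
Unset Strict Implicit.
Unset Printing Implicit Defensive.
Import Order.TTheory GRing.Theory Num.Theory.
Import numFieldNormedType.Exports.

Local Open Scope classical_set_scope.
Local Open Scope ring_scope.

Definition spd {R : realType} {m : nat} (A : 'M[R]_m) : Prop :=
  A^T = A /\ forall u : 'cV[R]_m, u != 0 -> 0 < (u^T *m A *m u) 0 0.

(* [Ck k f] is the class C^k as long as V is finite-dimensional, the only case
   used below: continuity of all directional derivatives is then continuity of
   the differential. *)
Fixpoint Ck {R : realType} {V W : normedModType R} (k : nat) (f : V -> W)
    : Prop :=
  if k is k'.+1 then
    (forall x, differentiable f x) /\ (forall v, Ck k' (fun x => 'D_v f x))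
  else continuous f.

Definition smooth {R : realType} {V W : normedModType R} (f : V -> W) : Prop :=
  forall k, Ck k f.

Definition grad {R : realType} {m : nat} (f : 'cV[R]_m -> R) (q : 'cV[R]_m)
    : 'cV[R]_m :=
  \col_j 'D_(delta_mx j 0) f q.

(* (nabla f q) j i = d f_i / d q_j : the transpose of the usual Jacobian. *)
Definition nabla {R : realType} {m k : nat} (f : 'cV[R]_m -> 'cV[R]_k)
    (q : 'cV[R]_m) : 'M[R]_(m, k) :=
  \matrix_(j, i) 'D_(delta_mx j 0) (fun q' => f q' i 0) q.

(* States (q, z, p, p^z). *)
Definition state (R : realType) (d n : nat) : Type :=
  ('cV[R]_d * 'cV[R]_n * 'cV[R]_d * 'cV[R]_n)%type.

Definition posq {R : realType} {d n : nat} (x : state R d n) : 'cV[R]_d :=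
  x.1.1.1.
Definition posz {R : realType} {d n : nat} (x : state R d n) : 'cV[R]_n :=
  x.1.1.2.
Definition momp {R : realType} {d n : nat} (x : state R d n) : 'cV[R]_d :=
  x.1.2.
Definition mompz {R : realType} {d n : nat} (x : state R d n) : 'cV[R]_n :=
  x.2.

Section Potentials.
Context {R : realType} {d n : nat}.
Context (M : 'M[R]_d) (Mz : 'M[R]_n) (beta : R) (xi : 'cV[R]_d -> 'cV[R]_n).

Definition Mnu (nu : R) (q : 'cV[R]_d) : 'M[R]_d :=
  M + nu ^+ 2 *: (nabla xi q *m Mz *m (nabla xi q)^T).

Definition Vfix_nu (nu : R) (q : 'cV[R]_d) : R :=
  (2 * beta)^-1 * ln (\det (Mnu nu q)).

Definition Gmx (q : 'cV[R]_d) : 'M[R]_n :=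
  (nabla xi q)^T *m invmx M *m nabla xi q.

Definition Vfix (q : 'cV[R]_d) : R := (2 * beta)^-1 * ln (\det (Gmx q)).

End Potentials.

Section Integrator.
Context {R : realType} {d n : nat}.
Context (M : 'M[R]_d) (Mz : 'M[R]_n).
Context (U : 'cV[R]_d -> 'cV[R]_n -> R) (xi : 'cV[R]_d -> 'cV[R]_n) (dt : R).
Context (a b : R) (W : 'cV[R]_d -> R).

Definition admissible (x : state R d n) : Prop :=
  xi (posq x) = b *: posz x /\
  (nabla xi (posq x))^T *m invmx M *m momp x = b *: (invmx Mz *m mompz x).

(* Half-step momenta and new positions, as functions of the current state x
   and of the first multiplier. *)
Definition p_half (x : state R d n) (lam : 'cV[R]_n) : 'cV[R]_d :=
  momp x
  - (dt / 2) *: (grad (fun q => U q (a^-1 *: posz x)) (posq x)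
                 + grad W (posq x))
  - nabla xi (posq x) *m lam.

Definition pz_half (x : state R d n) (lam : 'cV[R]_n) : 'cV[R]_n :=
  mompz x - (dt / (2 * a)) *: grad (U (posq x)) (a^-1 *: posz x) + b *: lam.

Definition q_next (x : state R d n) (lam : 'cV[R]_n) : 'cV[R]_d :=
  posq x + dt *: (invmx M *m p_half x lam).

Definition z_next (x : state R d n) (lam : 'cV[R]_n) : 'cV[R]_n :=
  posz x + dt *: (invmx Mz *m pz_half x lam).

(* One step x |-> y with multipliers lam (position constraint) and mu
   (velocity constraint); the last clause contains both constraints. *)
Definition is_step (x : state R d n) (lam mu : 'cV[R]_n) (y : state R d n)
    : Prop :=
  [/\ posq y = q_next x lam,
      posz y = z_next x lam,
      momp y =
        p_half x lam
        - (dt / 2) *: (grad (fun q => U q (a^-1 *: posz y)) (posq y)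
                       + grad W (posq y))
        - nabla xi (posq y) *m mu,
      mompz y =
        pz_half x lam
        - (dt / (2 * a)) *: grad (U (posq y)) (a^-1 *: posz y) + b *: mu
    & admissible y].

Definition step (x y : state R d n) : Prop :=
  exists lam mu, is_step x lam mu y.

(* The implicit equation is xi (q_{n+1}) - b z_{n+1} = 0, in the unknown lam;
   it is well-posed at a solution where its Jacobian is invertible.  The
   equation for mu is affine, with matrix
   nabla^T xi M^{-1} nabla xi + b^2 Mz^{-1} at q_{n+1}, which is invertible
   when the Jacobian of xi has full rank there. *)
Definition wellposed_step (x y : state R d n) : Prop :=
  exists lam mu,
    is_step x lam mu y /\
    nabla (fun l => xi (q_next x l) - b *: z_next x l) lam \in unitmx.

End Integrator.

(* On a domain X, with values in Y, the relation S (between admissible states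
   and their images) is a map. *)
Definition maps_into {R : realType} {d n : nat} (A : set (state R d n))
    (S : state R d n -> state R d n -> Prop) (X Y : set (state R d n)) : Prop :=
  forall x, X x -> A x -> exists! y, Y y /\ S x y.

Definition flow {R : realType} {d n : nat}
    (S : state R d n -> state R d n -> Prop) (Y : set (state R d n))
    (x : state R d n) : state R d n :=
  get [set y | Y y /\ S x y].

Definition hamiltonian {R : realType} {d n : nat} (M : 'M[R]_d) (Mz : 'M[R]_n)
    (U : 'cV[R]_d -> 'cV[R]_n -> R) (a : R) (W : 'cV[R]_d -> R)
    (x : state R d n) : R :=
  2^-1 * ((momp x)^T *m invmx M *m momp x) 0 0
  + 2^-1 * ((mompz x)^T *m invmx Mz *m mompz x) 0 0
  + U (posq x) (a^-1 *: posz x) + W (posq x).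

Section ConstrainedVerlet.
Context {R : realType} {d n : nat}.
Context (dt : R) (H : state R d n -> R) (g : 'cV[R]_d -> 'cV[R]_n -> 'cV[R]_n).

Definition dHq (x : state R d n) : 'cV[R]_d :=
  grad (fun q => H (q, posz x, momp x, mompz x)) (posq x).
Definition dHz (x : state R d n) : 'cV[R]_n :=
  grad (fun z => H (posq x, z, momp x, mompz x)) (posz x).
Definition dHp (x : state R d n) : 'cV[R]_d :=
  grad (fun p => H (posq x, posz x, p, mompz x)) (momp x).
Definition dHpz (x : state R d n) : 'cV[R]_n :=
  grad (fun pz => H (posq x, posz x, momp x, pz)) (mompz x).

Definition dgq (x : state R d n) : 'M[R]_(d, n) :=
  nabla (fun q => g q (posz x)) (posq x).
Definition dgz (x : state R d n) : 'M[R]_(n, n) :=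
  nabla (g (posq x)) (posz x).

(* Velocity-Verlet (RATTLE) step for a separable Hamiltonian H(position,
   momentum) under the constraint g = 0 on positions. *)
Definition constrained_verlet (x y : state R d n) : Prop :=
  exists (lam mu : 'cV[R]_n) (ph : 'cV[R]_d) (pzh : 'cV[R]_n),
    let xh := (posq x, posz x, ph, pzh) in
    let yh := (posq y, posz y, ph, pzh) in
    [/\ ph = momp x - (dt / 2) *: dHq x - dgq x *m lam /\
        pzh = mompz x - (dt / 2) *: dHz x - dgz x *m lam,
        posq y = posq x + dt *: dHp xh /\ posz y = posz x + dt *: dHpz xh,
        g (posq y) (posz y) = 0,
        momp y = ph - (dt / 2) *: dHq yh - dgq y *m mu /\
        mompz y = pzh - (dt / 2) *: dHz yh - dgz y *m mu
      & (dgq y)^T *m dHp y + (dgz y)^T *m dHpz y = 0].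

End ConstrainedVerlet.

(* Main.v *)
Require Import Defs.
From HB Require Import structures.
From mathcomp Require Import all_boot all_order all_algebra.
From mathcomp Require Import all_classical all_reals all_analysis.
From mathcomp Require Import ring lra.
Set Implicit Arguments.
Unset Strict Implicit.
Unset Printing Implicit Defensive.
Import Order.TTheory GRing.Theory Num.Theory.
Import numFieldNormedType.Exports.

Local Open Scope classical_set_scope.
Local Open Scope ring_scope.

(* The matrix determinant lemma gives
     det (M + nu^2 J Mz J^T) = det M * nu^(2n) * det Mz * det (G + nu^-2 Mz^-1),
   so, up to a constant, Vfix_nu is (2 beta)^-1 ln det (G + b^2 Mz^-1) with
   b = 1 / nu, and both schemes belong to a single family that is continuous in
   (a, b), with (a, b) = (nu eps * eps, 1 / nu eps) tending to (nubar, 0).  As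
   xi is strictly differentiable and the Jacobian of the position constraint is
   invertible at the limit step, the first multiplier is given by an implicit
   function theorem, uniformly in (a, b) and in the initial state; the second
   one solves a linear system with matrix G + b^2 Mz^-1. *)

(** * Symmetric positive definite matrices *)

(** As [eps] tends to 0, [nu eps] tends to infinity, and for [n > 0] the potentials [Vfix_nu]
    diverge on the slow manifold; a step sees a potential only through its gradient, and the
    divergent part is constant in [q]. The sets between which a flow is a map must not shrink with
    [eps], so an implicit function theorem applied separately for each [eps] would not do: existence
    and uniqueness have to hold on balls whose radii are fixed near the limit parameter. This rests
    on strict differentiability in the multiplier, uniform in the parameter, while the dependence on
    [(a, b)] and on the state is merely continuous. Since a flow is defined through uniqueness of
    the final state and not of the multipliers, the first multiplier also has to be recovered
    continuously from the two ends of a step, which is possible because G is invertible at the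
    initial position. *)

Section LinearAlgebra.
Context {R : realType}.

(** Sylvester's identity: the block matrix with rows [(1, - A)] and [(B, 1)] has two factorisations
    into block triangular matrices, whose determinants are the two sides. *)
Lemma det_1D_mulmx_comm m n (A : 'M[R]_(m, n)) (B : 'M[R]_(n, m)) :
  \det (1%:M + A *m B) = \det (1%:M + B *m A).
Proof.
have lower : block_mx 1%:M 0 B 1%:M *m block_mx 1%:M (- A) 0 (1%:M + B *m A)
    = block_mx 1%:M (- A) B 1%:M.
  rewrite mulmx_block !mul1mx !mul0mx mulmx1 !addr0.
  by rewrite mulmxN addrCA addNr addr0.
have upper : block_mx (1%:M + A *m B) (- A) 0 1%:M *m block_mx 1%:M 0 B 1%:M
    = block_mx 1%:M (- A) B 1%:M.
  rewrite mulmx_block !mul1mx !mul0mx !mulmx1 !mulmx0 !add0r.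
  by rewrite mulNmx addrK.
have := congr1 (fun C => \det C) (etrans upper (esym lower)).
by rewrite !det_mulmx !det_ublock !det_lblock !det1 !mul1r !mulr1.
Qed.

Lemma spd_unitmx m (A : 'M[R]_m) : spd A -> A \in unitmx.
Proof.
move=> [_ pA]; rewrite -row_free_unit -kermx_eq0.
apply/eqP/row_matrixP => i; rewrite row0.
have [//|ui0] := eqVneq (row i (kermx A)) 0.
have := pA (row i (kermx A))^T.
rewrite trmxK -row_mul mulmx_ker row0 mul0mx mxE ltxx -trmx0.
rewrite (inj_eq trmx_inj) => /(_ ui0).
by [].
Qed.

Lemma spd_invmx m (A : 'M[R]_m) : spd A -> spd (invmx A).
Proof.
move=> sA; have uA := spd_unitmx sA; case: sA => tA pA.
split=> [|u u0]; first by rewrite trmx_inv tA.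
have iu0 : invmx A *m u != 0.
  apply: contra_neq u0 => iu.
  by rewrite -[u](mulKVmx uA) iu mulmx0.
by have := pA _ iu0; rewrite trmx_mul trmx_inv tA -!mulmxA mulKVmx.
Qed.

Lemma spd1 m : spd (1%:M : 'M[R]_m).
Proof.
split=> [|u u0]; first by rewrite trmx1.
rewrite mulmx1 mxE.
have [i ui] : exists i, u i 0 != 0.
  apply/existsP; apply: contraNT u0; rewrite negb_exists => /forallP u0.
  apply/eqP/matrixP => i j; rewrite mxE ord1.
  by apply/eqP; rewrite -[_ == _]negbK.
rewrite (bigD1 i)//= ltr_wpDr//.
  by apply: sumr_ge0 => j _; rewrite mxE -expr2 sqr_ge0.
by rewrite mxE -expr2 exprn_even_gt0.
Qed.

Lemma spd_combination m (A B : 'M[R]_m) (s t : R) :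
  spd A -> spd B -> 0 <= s -> 0 <= t -> 0 < s + t -> spd (s *: A + t *: B).
Proof.
move=> [tA pA] [tB pB] s0 t0 st0; split=> [|u u0].
  by rewrite linearD !linearZ/= tA tB.
rewrite mulmxDr mulmxDl -!scalemxAr -!scalemxAl.
rewrite !mxE.
move: (pA u u0) (pB u u0); rewrite !mxE => a0 b0.
move: s0; rewrite le_eqVlt => /predU1P[s0|s0].
  by move: st0; rewrite -s0 add0r mul0r add0r => st0; rewrite mulr_gt0.
by apply: ltr_wpDr; [rewrite mulr_ge0// ltW|rewrite mulr_gt0].
Qed.

(* The segment from the identity to A consists of invertible matrices, so the
   polynomial det (1 + t (A - 1)) has no root in [0, 1]. *)
Lemma det_spd_gt0 m (A : 'M[R]_m) : spd A -> 0 < \det A.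
Proof.
move=> sA; rewrite ltNge; apply/negP => dA.
pose P : {poly R} := \det (map_mx polyC 1%:M + 'X *: map_mx polyC (A - 1%:M)).
have PE t : P.[t] = \det (1%:M + t *: (A - 1%:M)).
  rewrite /P -[LHS]/(horner_eval t _) -det_map_mx; congr (\det _).
  apply/matrixP => i j; rewrite !mxE /horner_eval.
  by rewrite rmorphD rmorphM /= /horner_eval hornerX !hornerC.
have P0 : 0 <= P.[0] by rewrite PE scale0r addr0 det1 ler01.
have P1 : P.[1] <= 0 by rewrite PE scale1r addrC subrK.
have [t /andP[t0 t1] rt] :
    exists2 t, 0 <= t <= 1 & root (- P) t.
  apply: poly_ivt; rewrite ?ler01// !hornerN.
  by rewrite oppr_le0 P0 oppr_ge0 P1.
have sC : spd ((1 - t) *: 1%:M + t *: A).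
  apply: spd_combination => //; rewrite ?subr_ge0 ?subrK ?ltr01//.
  exact: spd1.
have := spd_unitmx sC; rewrite unitmxE unitfE.
have -> : (1 - t) *: 1%:M + t *: A = 1%:M + t *: (A - 1%:M).
  by rewrite scalerBl scale1r scalerBr addrA addrAC.
by rewrite -PE; move: rt; rewrite rootN /root => ->.
Qed.

Lemma full_rank_mulmx_eq0 m n (J : 'M[R]_(m, n)) (u : 'cV[R]_n) :
  \rank J = n -> J *m u = 0 -> u = 0.
Proof.
move=> rJ Ju0; have fJ : row_free J^T by rewrite -row_leq_rank mxrank_tr rJ.
apply: trmx_inj; rewrite trmx0; apply: (row_free_inj fJ).
by rewrite -trmx_mul Ju0 trmx0 mul0mx.
Qed.

Lemma spd_gram m n (A : 'M[R]_m) (J : 'M[R]_(m, n)) :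
  spd A -> \rank J = n -> spd (J^T *m A *m J).
Proof.
move=> [tA pA] rJ; split=> [|u u0].
  by rewrite !trmx_mul trmxK tA mulmxA.
have Ju0 : J *m u != 0.
  by apply: contra_neq u0 => /(full_rank_mulmx_eq0 rJ).
by have := pA _ Ju0; rewrite trmx_mul !mulmxA.
Qed.

(** The term [t *: C] supplies definiteness by itself, so [J] may be degenerate; for nonzero [b] the
    matrix G + b^2 Mz^-1 is therefore definite at every point, not only near the slow manifold. *)
Lemma spd_gramD m n (A : 'M[R]_m) (J : 'M[R]_(m, n)) (C : 'M[R]_n) (t : R) :
  spd A -> spd C -> 0 < t -> spd (J^T *m A *m J + t *: C).
Proof.
move=> [tA pA] [tC pC] t0; split=> [|u u0].
  by rewrite linearD linearZ/= !trmx_mul trmxK tA tC mulmxA.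
rewrite mulmxDr mulmxDl -scalemxAr -scalemxAl mxE [X in _ + X]mxE.
rewrite ltr_wpDl ?mulr_gt0 ?pC//.
have [Ju0|Ju0] := eqVneq (J *m u) 0.
  by rewrite -!mulmxA Ju0 !mulmx0 mxE.
by have := ltW (pA _ Ju0); rewrite trmx_mul !mulmxA.
Qed.

End LinearAlgebra.

(** * Limits of matrix-valued maps along a filter *)

Section MatrixLimits.
Context {R : realType} {T : Type} {F : set_system T} {FF : Filter F}.

Lemma cvg_mxP m n (A : T -> 'M[R]_(m, n)) (B : 'M[R]_(m, n)) :
  A t @[t --> F] --> B <-> forall i j, A t i j @[t --> F] --> B i j.
Proof.
split=> [AB i j|AB S [P BP PS]].
  exact: (cvg_comp _ _ AB (@coord_continuous _ _ _ i j B)).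
have : \forall t \near F, forall i j, P i j (A t i j).
  apply: filter_forall => i; apply: filter_forall => j.
  exact: AB (BP i j).
by apply: filterS => t; exact: PS.
Qed.

Lemma cvg_mulmx m n k (A : T -> 'M[R]_(m, n)) (B : T -> 'M[R]_(n, k))
    (A0 : 'M[R]_(m, n)) (B0 : 'M[R]_(n, k)) :
  A t @[t --> F] --> A0 -> B t @[t --> F] --> B0 ->
  A t *m B t @[t --> F] --> A0 *m B0.
Proof.
move=> /cvg_mxP AA0 /cvg_mxP BB0; apply/cvg_mxP => i j.
under eq_fun do rewrite mxE; rewrite mxE.
by apply: (cvg_big add_continuous) => l _; apply: cvgM.
Qed.

Lemma cvg_trmx m n (A : T -> 'M[R]_(m, n)) (A0 : 'M[R]_(m, n)) :
  A t @[t --> F] --> A0 -> (A t)^T @[t --> F] --> A0^T.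
Proof.
move=> /cvg_mxP AA0; apply/cvg_mxP => i j.
by under eq_fun do rewrite mxE; rewrite mxE; exact: AA0.
Qed.

Lemma cvg_det n (A : T -> 'M[R]_n) (A0 : 'M[R]_n) :
  A t @[t --> F] --> A0 -> \det (A t) @[t --> F] --> \det A0.
Proof.
move=> /cvg_mxP AA0; apply: (cvg_big add_continuous) => s _.
by apply: cvgM; [exact: cvg_cst|exact: (cvg_big mul_continuous)].
Qed.

(** Near [A0] the determinant stays nonzero, so [invmx] is eventually the adjugate divided by the
    determinant, both polynomial in the entries. *)
Lemma cvg_invmx n (A : T -> 'M[R]_n) (A0 : 'M[R]_n) :
  A0 \in unitmx -> A t @[t --> F] --> A0 ->
  invmx (A t) @[t --> F] --> invmx A0.
Proof.
move=> uA0 AA0; have dA := cvg_det AA0.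
have d0 : \det A0 != 0 by rewrite -unitfE -unitmxE.
have ut : \forall t \near F, A t \in unitmx.
  have := @cvgr_neq0 _ _ _ _ FF _ _ dA d0.
  by apply: filterS => t; rewrite unitmxE unitfE.
have -> : invmx A0 = (\det A0)^-1 *: \adj A0 by rewrite /invmx uA0.
have adjA : \adj (A t) @[t --> F] --> \adj A0.
  apply/cvg_mxP => i j; rewrite mxE; under eq_fun do rewrite mxE.
  apply: cvgM; first exact: cvg_cst.
  apply: cvg_det; apply/cvg_mxP => k l; rewrite !mxE.
  under eq_fun do rewrite !mxE.
  by move/cvg_mxP: AA0; apply.
have : (\det (A t))^-1 *: \adj (A t) @[t --> F] --> (\det A0)^-1 *: \adj A0.
  by apply: cvgZ => //; exact: cvgV.
apply: cvg_trans; apply: near_eq_cvg; apply: filterS ut => t ut.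
by rewrite /invmx ut.
Qed.

End MatrixLimits.

(** * A uniform implicit function theorem *)

(** Joins completeness to the normed module structure of matrices, for the Banach fixed point
    theorem below. *)
HB.instance Definition _ (R : realType) (m n : nat) := Complete.on 'M[R]_(m, n).

Section MatrixNorm.
Context {R : realType}.

Lemma normmx_ge_coord m n (A : 'M[R]_(m, n)) i j : `|A i j| <= `|A|.
Proof. by rewrite [leRHS]/Num.norm/= mx_normrE (le_bigmax _ _ (i, j)). Qed.

Lemma normmx_le m n (A : 'M[R]_(m, n)) (e : R) :
  0 <= e -> (forall i j, `|A i j| <= e) -> `|A| <= e.
Proof.
move=> e0 Ae; rewrite /Num.norm/= mx_normrE.
by apply: bigmax_le => // -[i j] _; exact: Ae.
Qed.

(** The norm is the largest absolute value of an entry, hence not submultiplicative: an entry of the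
    product is a sum of [n] terms. This factor is the source of the [n%:R + 1] in later
    constants. *)
Lemma normmx_mulmx m n k (A : 'M[R]_(m, n)) (B : 'M[R]_(n, k)) :
  `|A *m B| <= n%:R * `|A| * `|B|.
Proof.
apply: normmx_le => [|i j]; first by rewrite !mulr_ge0.
rewrite mxE (le_trans (ler_norm_sum _ _ _))//.
apply: (@le_trans _ _ (\sum_(l < n) `|A| * `|B|)).
  by apply: ler_sum => l _; rewrite normrM ler_pM ?normmx_ge_coord.
by rewrite sumr_const card_ord -[leLHS]mulr_natl mulrA.
Qed.

End MatrixNorm.

Section ImplicitFunction.
Context {R : realType} {P : topologicalType} {n : nat}.
Variables (F : P -> 'cV[R]_n -> 'cV[R]_n) (p0 : P) (l0 : 'cV[R]_n).
Variable A : 'M[R]_n.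
Hypothesis uA : A \in unitmx.
(** Strict differentiability in [l] at [l0], with one radius for all [p] near [p0] and the same
    derivative [A] for all of them; hence [P] need only be a topological space. *)
Hypothesis dF : forall eta : R, 0 < eta -> exists2 r : R, 0 < r &
  \forall p \near p0, forall l l', ball l0 r l -> ball l0 r l' ->
    `|F p l - F p l' - A *m (l - l')| <= eta * `|l - l'|.

Let K := n%:R * `|invmx A| + 1.

Let K_gt0 : 0 < K.
Proof. by rewrite ltr_wpDl// mulr_ge0. Qed.

Let invmx_bound (v : 'cV[R]_n) : `|invmx A *m v| <= K * `|v|.
Proof.
by rewrite (le_trans (normmx_mulmx _ _))// ler_wpM2r// lerDl.
Qed.

Let K_half (x : R) : K * ((2 * K)^-1 * x) = x / 2.
Proof. by rewrite invfM -mulrA mulrCA mulVKf ?gt_eqF// mulrC. Qed.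

(** With [eta = (2 * K)^-1] the linearisation error costs at most half of [|l - l'|] and is absorbed
    on the left, whence [C = 2 * K]. The estimate yields both uniqueness of a zero in the ball and
    its continuity in [p]. *)
Lemma implicit_lipschitz : exists C : R, exists2 r : R, 0 < r &
  \forall p \near p0, forall l l', ball l0 r l -> ball l0 r l' ->
    `|l - l'| <= C * `|F p l - F p l'|.
Proof.
have e0 : 0 < (2 * K)^-1 by rewrite invr_gt0 mulr_gt0.
have [r r0 dFr] := dF e0; exists (2 * K), r => //.
apply: filterS dFr => p dFp l l' lr l'r.
have h1 := dFp _ _ lr l'r.
have h2 : `|l - l'| <= K * `|A *m (l - l')|.
  by rewrite -{1}[l - l'](mulKmx uA); exact: invmx_bound.
have h3 : `|A *m (l - l')| <= `|F p l - F p l'| + (2 * K)^-1 * `|l - l'|.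
  rewrite -[A *m _](subKr (F p l - F p l')).
  by rewrite (le_trans (ler_normB _ _))// lerD2l.
have h4 : `|l - l'| <= K * `|F p l - F p l'| + `|l - l'| / 2.
  rewrite (le_trans h2)// (le_trans (ler_wpM2l (ltW K_gt0) h3))// mulrDr.
  by rewrite K_half.
move: h4; rewrite [X in X <= _ -> _](splitr `|l - l'|) lerD2r => h4.
by rewrite -mulrA -ler_pdivrMl// mulrC.
Qed.

(** Newton's map with derivative frozen at [A] contracts the closed ball of radius [s] by 1/2. It
    maps this ball to itself once its first move from [l0] is at most [s / 2], which holds for [p]
    near [p0]; its fixed points are zeros because [A] is invertible. *)
Lemma implicit_solution : F p0 l0 = 0 ->
    {for p0, continuous (F ^~ l0)} ->
  forall r : R, 0 < r ->
    \forall p \near p0, exists2 l, ball l0 r l & F p l = 0.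
Proof.
move=> F0 cF r r0.
have e0 : 0 < (2 * K)^-1 by rewrite invr_gt0 mulr_gt0.
have [r1 r10 dFr] := dF e0.
(* Halving puts the closed ball of radius [s], which is complete, inside both open balls. *)
pose s := Num.min r r1 / 2.
have m0 : 0 < Num.min r r1 by rewrite lt_min r0.
have s0 : 0 < s by rewrite divr_gt0.
have sm : s < Num.min r r1 by rewrite /s ltr_pdivrMr// ltr_pMr// ltr1n.
have small : \forall p \near p0, `|F p l0| <= (2 * K)^-1 * s.
  move/cvgrPdist_le : cF => /(_ ((2 * K)^-1 * s)).
  rewrite mulr_gt0// => /(_ isT); apply: filterS => p.
  by rewrite F0 sub0r normrN.
near=> p.
have dFp : forall l l', ball l0 r1 l -> ball l0 r1 l' ->
    `|F p l - F p l' - A *m (l - l')| <= (2 * K)^-1 * `|l - l'|.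
  by near: p.
have Fp : `|F p l0| <= (2 * K)^-1 * s by near: p.
pose U := [set l : 'cV[R]_n | `|l0 - l| <= s].
have Ur1 l : U l -> ball l0 r1 l.
  move=> Ul; rewrite -ball_normE /= (le_lt_trans Ul)// (lt_le_trans sm)//.
  by rewrite ge_min lexx orbT.
pose T l := l - invmx A *m F p l.
have Tlip l l' : U l -> U l' -> `|T l - T l'| <= 2^-1 * `|l - l'|.
  move=> Ul Ul'.
  have -> : T l - T l' = - (invmx A *m (F p l - F p l' - A *m (l - l'))).
    rewrite mulmxBr mulKmx// /T mulmxBr opprB opprB opprD opprK.
    by rewrite [in LHS](addrC _ (- l')) addrACA.
  rewrite normrN (le_trans (invmx_bound _))//.
  rewrite (le_trans (ler_wpM2l (ltW K_gt0) (dFp _ _ (Ur1 _ Ul) (Ur1 _ Ul'))))//.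
  by rewrite K_half mulrC.
have Ul0 : U l0 by rewrite /U/= subrr normr0 ltW.
have TU : set_fun U U T.
  move=> l Ul; rewrite /U/=.
  have -> : l0 - T l = (T l0 - T l) + invmx A *m F p l0.
    by rewrite {2}/T addrAC subrK.
  rewrite (le_trans (ler_normD _ _))// [leRHS]splitr lerD//.
    rewrite (le_trans (Tlip _ _ Ul0 Ul))// mulrC ler_wpM2r//.
  rewrite (le_trans (invmx_bound _))// (le_trans (ler_wpM2l (ltW K_gt0) Fp))//.
  by rewrite K_half.
pose f : {fun U >-> U} := mkfun_fun TU.
have cf : is_contraction f.
  exists (2^-1)%:nng; split => /=; first by rewrite invf_lt1// ltr1n.
  by move=> [l l'] [/= Ul Ul']; exact: Tlip.
have clU : closed U.
  have -> : U = closed_ball_ Num.norm l0 s by [].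
  exact: closed_closed_ball_.
have [l Ul Tl] := banach_fixed_point cf clU (ex_intro _ l0 Ul0).
exists l.
  by rewrite -ball_normE /= (le_lt_trans Ul)// (lt_le_trans sm)// ge_min lexx.
have : invmx A *m F p l = 0.
  by apply/eqP; rewrite -oppr_eq0 -(addKr l (- _)) -/(T l) -[T l]Tl addNr.
by move/(congr1 (mulmx A)); rewrite mulKVmx// mulmx0.
Unshelve. all: by end_near. Qed.

End ImplicitFunction.

(* A relation on X depending on a parameter q, whose pairs (x, y) are locally
   parametrised by the zeros l of F (q, x): y = Y (q, x) l and l = L (q, x) y.
   It is then locally the graph of a map that is continuous in (q, x). *)
Section ImplicitRelation.
Context {R : realType} {Q X : topologicalType} {n : nat}.
Variable S : Q -> X -> X -> Prop.
Variables (F : Q * X -> 'cV[R]_n -> 'cV[R]_n) (Y : Q * X -> 'cV[R]_n -> X).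
Variable L : Q * X -> X -> 'cV[R]_n.
Variables (q0 : Q) (x0 y0 : X) (l0 : 'cV[R]_n) (A : 'M[R]_n).
Let p0 : Q * X := (q0, x0).
Hypothesis uA : A \in unitmx.
Hypothesis dF : forall eta : R, 0 < eta -> exists2 r : R, 0 < r &
  \forall p \near p0, forall l l', ball l0 r l -> ball l0 r l' ->
    `|F p l - F p l' - A *m (l - l')| <= eta * `|l - l'|.
Hypothesis L0 : L p0 y0 = l0.
Hypothesis F0 : F p0 l0 = 0.
Hypothesis Y0 : Y p0 l0 = y0.
Hypothesis SF : \forall w \near (p0, y0), S w.1.1 w.1.2 w.2 ->
  F w.1 (L w.1 w.2) = 0 /\ w.2 = Y w.1 (L w.1 w.2).
Hypothesis FS : \forall w \near (p0, l0), F w.1 w.2 = 0 ->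
  S w.1.1 w.1.2 (Y w.1 w.2).
Hypothesis cL : {for (p0, y0), continuous (fun w => L w.1 w.2)}.
Hypothesis cF : \forall w \near (p0, l0),
  {for w, continuous (fun w => F w.1 w.2)}.
Hypothesis cY : \forall w \near (p0, l0),
  {for w, continuous (fun w => Y w.1 w.2)}.

(** [X0] and [Y0] are chosen before [q], so all relations near [q0] are maps between the same sets.
    Convergence is claimed at every [x] of [X0], not just at [x0], which is why [cF] and [cY] ask
    for continuity on a neighbourhood. *)
Lemma implicit_relation : exists X0 Y0 : set X,
  [/\ open_nbhs x0 X0, open_nbhs y0 Y0,
      \forall q \near q0, forall x, X0 x -> exists! y, Y0 y /\ S q x y
    & forall (T : Type) (G : set_system T) (FG : Filter G) (q_ : T -> Q)
        (x_ y_ : T -> X) x y,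
        X0 x -> Y0 y -> S q0 x y -> q_ @ G --> q0 -> x_ @ G --> x ->
        (\forall t \near G, Y0 (y_ t) /\ S (q_ t) (x_ t) (y_ t)) ->
        y_ @ G --> y].
Proof.
have [C [r1 r1_gt0 lip]] := implicit_lipschitz uA dF.
have [[N2 B2] [/= N2p B2l] NB2] := filterI FS (filterI cF cY).
have [r2 r2_gt0 B2r] := (nbhs_ballP _ _).1 B2l.
pose r := Num.min r1 r2.
have r_gt0 : 0 < r by rewrite lt_min r1_gt0.
have br1 l : ball l0 r l -> ball l0 r1 l by apply: le_ball; rewrite ge_min lexx.
have br2 l : ball l0 r l -> B2 l.
  by move=> br; apply: B2r; apply: le_ball br; rewrite ge_min lexx orbT.
have Lr : \forall w \near (p0, y0), ball l0 r (L w.1 w.2).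
  by apply: cL; rewrite /= L0; exact: nbhsx_ballx.
have [[N3 B3] [/= N3p B3y] NB3] := filterI SF Lr.
(* The state built from a zero must fall in the set where uniqueness is asserted, the interior of
   [B3]; zeros are therefore sought in a ball of radius at most [r4], smaller than the one used for
   uniqueness if need be. *)
have Y3 : \forall w \near (p0, l0), B3° (Y w.1 w.2).
  have := nbhs_singleton cY => /= cY0.
  by apply: cY0; rewrite /= Y0; exact: nbhs_interior.
have [[N4 B4] [/= N4p B4l] NB4] := Y3.
have [r4 r4_gt0 B4r] := (nbhs_ballP _ _).1 B4l.
have cF0 : {for p0, continuous (F ^~ l0)}.
  have cF1 : F w.1 w.2 @[w --> (p0, l0)] --> F p0 l0 := nbhs_singleton cF.
  have idp : p @[p --> p0] --> p0 by exact: cvg_id.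
  exact: (continuous2_cvg _ cF1 idp (cvg_cst l0)).
have r5_gt0 : 0 < Num.min r r4 by rewrite lt_min r_gt0.
have sol := implicit_solution uA dF F0 cF0 r5_gt0.
pose N := [set p | (forall l l', ball l0 r1 l -> ball l0 r1 l' ->
    `|l - l'| <= C * `|F p l - F p l'|) /\ N2 p /\ N3 p /\ N4 p /\
  (exists2 l, ball l0 (Num.min r r4) l & F p l = 0)].
have Np : nbhs p0 N.
  exact: filterI lip (filterI N2p (filterI N3p (filterI N4p sol))).
have [[Nq Nx] [/= Nqq Nxx] Nqx] := nbhs_interior Np.
exists Nx°, B3°; split.
- by split; [exact: open_interior|exact: nbhs_singleton (nbhs_interior Nxx)].
- by split; [exact: open_interior|exact: nbhs_singleton (nbhs_interior B3y)].
- apply: filterS Nqq => q Nq_q x /interior_subset Nx_x.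
  have /= /interior_subset[lipqx [N2q [N3q [N4q [l lr Fl]]]]] :=
    Nqx (q, x) (conj Nq_q Nx_x).
  have lr' : ball l0 r l by apply: le_ball lr; rewrite ge_min lexx.
  have l4 : B4 l by apply: B4r; apply: le_ball lr; rewrite ge_min lexx orbT.
  have [/= FSl _] := NB2 ((q, x), l) (conj N2q (br2 _ lr')).
  have /= Yl := NB4 ((q, x), l) (conj N4q l4).
  have Sl := FSl Fl.
  exists (Y (q, x) l); split => // y [/[dup] yB3 /interior_subset yB Sy].
  have [/= /(_ Sy)[Fly {2}->] lyr] := NB3 ((q, x), y) (conj N3q yB).
  (* Both are zeros in the ball of radius [r1], where the Lipschitz estimate makes [F (q, x)]
     injective. *)
  suff -> : l = L (q, x) y by [].
  apply/eqP; rewrite -subr_eq0 -normr_le0.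
  rewrite (le_trans (lipqx _ _ (br1 _ lr') (br1 _ lyr)))//.
  by rewrite Fl Fly subrr normr0 mulr0.
- move=> T G FG q_ x_ y_ x y /[dup] Nx_x /interior_subset Nx_x' yB Sxy qq xx Gy.
  pose p : Q * X := (q0, x).
  have Nqx0 : N° p.
    exact: (Nqx (q0, x) (conj (nbhs_singleton Nqq) Nx_x')).
  have pp : (q_ t, x_ t) @[t --> G] --> p by exact: cvg_pair.
  have [lipp [N2q [N3q [N4q _]]]] := interior_subset Nqx0.
  have [/= /(_ Sxy)[Fly yE] lyr] :=
    NB3 (p, y) (conj N3q (interior_subset yB)).
  pose l := L p y; rewrite -/l in Fly yE lyr.
  have [/= _ [cFl cYl]] := NB2 (p, l) (conj N2q (br2 _ lyr)).
  have Gp : \forall t \near G, N (q_ t, x_ t) := pp _ Nqx0.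
  have Fl : F (q_ t, x_ t) l @[t --> G] --> (0 : 'cV[R]_n).
    rewrite -Fly; exact: (continuous2_cvg _ cFl pp (cvg_cst _)).
  have ll : L (q_ t, x_ t) (y_ t) @[t --> G] --> l.
    apply/cvgrPdist_le => e e_gt0.
    (* [C] comes without a sign; [|C| + 1] is a positive upper bound by which one can divide. *)
    have C1 : 0 < `|C| + 1 by rewrite ltr_wpDl.
    move/cvgrPdist_le : Fl => /(_ (e / (`|C| + 1))).
    rewrite divr_gt0// => /(_ isT) Fe.
    apply: filterS3 Gp Gy Fe => t [lipt [_ [N3t _]]] [yt St].
    rewrite sub0r normrN => Fe.
    have [/= /(_ St)[Flt _] ltr] :=
      NB3 ((q_ t, x_ t), y_ t) (conj N3t (interior_subset yt)).
    rewrite (le_trans (lipt _ _ (br1 _ lyr) (br1 _ ltr)))// Flt subr0.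
    rewrite (@le_trans _ _ ((`|C| + 1) * `|F (q_ t, x_ t) l|))//.
      by rewrite ler_wpM2r// (le_trans (ler_norm C))// lerDl.
    by rewrite mulrC -ler_pdivlMr.
  rewrite yE.
  have : Y (q_ t, x_ t) (L (q_ t, x_ t) (y_ t)) @[t --> G] --> Y p l.
    exact: (continuous2_cvg _ cYl pp ll).
  apply: cvg_trans; apply: near_eq_cvg.
  apply: filterS2 Gp Gy => t [_ [_ [N3t _]]] [yt St].
  by have [/= /(_ St)[_ <-] _] :=
    NB3 ((q_ t, x_ t), y_ t) (conj N3t (interior_subset yt)).
Unshelve. all: by end_near. Qed.

End ImplicitRelation.

(** * Differential calculus of smooth maps *)

Section Calculus.
Context {R : realType}.

Lemma normmx_tr m n (A : 'M[R]_(m, n)) : `|A^T| <= `|A|.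
Proof. by apply: normmx_le => // i j; rewrite mxE normmx_ge_coord. Qed.

(** The difference quotients of both sides coincide for every [h], so this chain rule works with
    directional derivatives alone. *)
Lemma derivable_comp_affine {U V W : normedModType R} (f : V -> W) (g : U -> V)
    (x u : U) (w : V) :
  (forall h : R, g (h *: u + x) = h *: w + g x) ->
  derivable f (g x) w -> derivable (fun y => f (g y)) x u.
Proof.
move=> gE; rewrite /derivable.
by under [X in _ -> cvg (X @ _)]eq_fun do rewrite /= gE.
Qed.

Lemma derive_comp_affine {U V W : normedModType R} (f : V -> W) (g : U -> V)
    (x u : U) (w : V) :
  (forall h : R, g (h *: u + x) = h *: w + g x) ->
  'D_u (fun y => f (g y)) x = 'D_w f (g x).
Proof. by move=> gE; rewrite /derive; under eq_fun do rewrite /= gE. Qed.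

(** Derivability is assumed in the direction [v] only, so the chain rule is applied on the real
    line, to the restriction [g] of [f] to the line through [x]. *)
Lemma is_derive_ln {V : normedModType R} (f : V -> R) (x v : V) :
  derivable f x v -> 0 < f x ->
  is_derive x v (fun y => ln (f y)) ((f x)^-1 * 'D_v f x).
Proof.
move=> df f0.
have lineE (h : R) : (h *: (1 : R) + 0) *: v + x = h *: v + ((0 : R) *: v + x).
  by rewrite addr0 scale0r add0r [_%:A]mulr1.
have x0 : (0 : R) *: v + x = x by rewrite scale0r add0r.
pose g := fun h : R => f (h *: v + x).
have lineD (h : V -> R) : 'D_v h x = 'D_1 (fun t : R => h (t *: v + x)) 0.
  by rewrite (derive_comp_affine h lineE) x0.
have dg : is_derive (0 : R) 1 g ('D_v f x).
  rewrite lineD.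
  apply/derivableP/(@derivable_comp_affine _ _ _ f _ _ _ _ lineE).
  by rewrite x0.
have dl : is_derive (g 0) 1 (@ln R) (f x)^-1.
  by rewrite /g x0; exact: is_derive1_ln.
have dc := is_derive1_comp dl dg.
split; first by apply/derivable1P; exact: ex_derive.
by rewrite lineD; case: dc.
Qed.

Lemma smooth_differentiable {V W : normedModType R} (f : V -> W) x :
  smooth f -> differentiable f x.
Proof. by move=> /(_ 1%N)[]. Qed.

Lemma smooth_derivable {V W : normedModType R} (f : V -> W) x v :
  smooth f -> derivable f x v.
Proof. by move=> sf; apply/diff_derivable/smooth_differentiable. Qed.

Lemma smooth_derive {V W : normedModType R} (f : V -> W) v :
  smooth f -> smooth (fun x => 'D_v f x).
Proof. by move=> sf k; have [_] := sf k.+1; apply. Qed.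

Lemma smooth_continuous {V W : normedModType R} (f : V -> W) :
  smooth f -> continuous f.
Proof. by move=> /(_ 0%N). Qed.

Section SmoothMap.
Context {m k : nat} (f : 'cV[R]_m -> 'cV[R]_k).
Hypothesis sf : smooth f.

Lemma derive_coord v i j x : 'D_v (fun y => f y i j) x = ('D_v f x) i j.
Proof. by rewrite (derive_mx (smooth_derivable sf)) mxE. Qed.

Lemma nablaE x j i : nabla f x j i = ('D_(delta_mx j 0) f x) i 0.
Proof. by rewrite mxE derive_coord. Qed.

Lemma derive_nabla v x : 'D_v f x = (nabla f x)^T *m v.
Proof.
have df := smooth_differentiable x sf.
rewrite deriveE// [in LHS](matrix_sum_delta v) linear_sum/=.
apply/matrixP => i j; rewrite summxE mxE; apply: eq_bigr => l _.
rewrite big_ord1 linearZ/= -deriveE// [j]ord1 !mxE mulrC.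
by rewrite derive_coord.
Qed.

Lemma cvg_nabla {T : Type} {F : set_system T} {FF : Filter F}
    (x_ : T -> 'cV[R]_m) (x : 'cV[R]_m) :
  x_ t @[t --> F] --> x -> nabla f (x_ t) @[t --> F] --> nabla f x.
Proof.
move=> xx; apply/cvg_mxP => j i; rewrite nablaE.
under eq_fun do rewrite nablaE.
have c := smooth_continuous (smooth_derive (delta_mx j 0) sf).
have : 'D_(delta_mx j 0) f (x_ t) @[t --> F] --> 'D_(delta_mx j 0) f x.
  exact: (continuous_cvg _ (c x) xx).
by move/cvg_mxP; apply.
Qed.

Let increment_remainder (a b : 'cV[R]_k) (A B : 'M[R]_(m, k)) (w : 'cV[R]_m) i :
  a i 0 - b i 0 = (A^T *m w) i 0 ->
  (a - b - B^T *m w) i 0 = - ((B - A)^T *m w) i 0.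
Proof.
move=> abE; have -> : (B - A)^T = B^T - A^T.
  by apply/matrixP => l j; rewrite !mxE.
by rewrite mulmxBl !mxE abE mxE opprB.
Qed.

(** By the mean value theorem on the segment from [x'] to [x], the error in component [i] is
    governed by [nabla f x0 - nabla f (g c)], which is small by continuity of [nabla f]. The point
    [c] depends on [i], which is harmless in the maximum norm. *)
Lemma smooth_strictly_differentiable x0 (eta : R) : 0 < eta ->
  \forall r \near 0^'+, forall x x', ball x0 r x -> ball x0 r x' ->
    `|f x - f x' - (nabla f x0)^T *m (x - x')| <= eta * `|x - x'|.
Proof.
move=> eta0; have m1 : 0 < m%:R + 1 :> R by rewrite ltr_wpDl.
have idx : x @[x --> x0] --> x0 by exact: cvg_id.
have : nabla f x @[x --> x0] --> nabla f x0 by exact: (cvg_nabla idx).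
move/cvgrPdist_le => /(_ (eta / (m%:R + 1))); rewrite divr_gt0// => /(_ isT).
move=> /nbhs_ballP[r1 /= r1_gt0 near_r1].
near=> r => x x' xr x'r.
pose w := x - x'.
pose g (t : R) := t *: w + x'.
have gE t h : g (h *: (1 : R) + t) = h *: w + g t.
  by rewrite /g [_%:A]mulr1 scalerDl addrA.
have g_near t : 0 < t < 1 -> ball x0 r1 (g t).
  move=> /andP[t0 t1]; have t1' : 0 <= 1 - t by rewrite subr_ge0 ltW.
  apply: (@le_ball _ _ _ r); first by near: r; exact: nbhs_right_le.
  move: xr x'r; rewrite -!ball_normE /= => xr x'r.
  have -> : x0 - g t = t *: (x0 - x) + (1 - t) *: (x0 - x').
    by apply/matrixP => a b; rewrite !mxE; ring.
  rewrite (le_lt_trans (ler_normD _ _))// !normrZ (ger0_norm t1') gtr0_norm//.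
  rewrite (@lt_le_trans _ _ (t * r + (1 - t) * r))//.
    by rewrite ltr_leD ?ltr_pM2l// ler_wpM2l// ltW.
  by rewrite -mulrDl subrKC mul1r.
apply: normmx_le => [|i j]; first by rewrite mulr_ge0// ltW.
rewrite [j]ord1 {j}.
pose phi (t : R) : R := f (g t) i 0.
have dphi (t : R) : is_derive t 1 phi (((nabla f (g t))^T *m w) i 0).
  have dfg : derivable (fun t : R => f (g t)) t 1.
    by apply: (derivable_comp_affine (gE t)); exact: smooth_derivable.
  split; first by move/derivable_mxP: dfg; apply.
  rewrite /phi (derive_comp_affine (fun y => f y i 0) (gE t)).
  by rewrite derive_coord derive_nabla.
have cphi : {within `[0, 1], continuous phi}.
  by apply: derivable_within_continuous => t _; exact: ex_derive.
have [c c01] := MVT ltr01 (fun t _ => dphi t) cphi.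
rewrite subr0 mulr1 /phi /g scale1r scale0r add0r /w subrK -/w -/(g c) => fE.
have -> : (f x - f x' - (nabla f x0)^T *m w) i 0
    = - ((nabla f x0 - nabla f (g c))^T *m w) i 0.
  exact: increment_remainder.
rewrite normrN (le_trans (normmx_ge_coord _ _ _))//.
rewrite (le_trans (normmx_mulmx _ _))// ler_wpM2r//.
have := near_r1 (g c) (g_near c _).
move: c01; rewrite in_itv/= => c01 /(_ c01) nab.
rewrite (@le_trans _ _ (m%:R * (eta / (m%:R + 1))))//.
  by rewrite ler_wpM2l// (le_trans (normmx_tr _)).
by rewrite mulrCA ler_piMr ?ltW// ltr_pdivrMr// mul1r ltrDl.
Unshelve. all: by end_near. Qed.

End SmoothMap.

End Calculus.

(** * The Fixman potentials *)

Section C1Family.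
Context {R : realType} {V : normedModType R}.
Implicit Types f g : R -> V -> R.

(** Derivatives are taken in the point only, with joint continuity in parameter and point: this is
    what convergence of gradients requires, and it passes to sums and products, hence to
    determinants. *)
Definition C1_family f :=
  [/\ forall b x v, derivable (f b) x v,
      continuous (fun w : R * V => f w.1 w.2)
    & forall v, continuous (fun w : R * V => 'D_v (f w.1) w.2)].

Lemma C1_family_param (h : R -> R) : continuous h -> C1_family (fun b _ => h b).
Proof.
move=> ch; split=> [b x v|w|v w]; first exact: derivable_cst.
  by apply: (continuous_cvg _ (ch w.1)); exact: cvg_fst.
by under eq_fun do rewrite derive_cst; exact: cvg_cst.
Qed.

Lemma C1_familyD f g : C1_family f -> C1_family g ->
  C1_family (fun b x => f b x + g b x).
Proof.
move=> [df cf Df] [dg cg Dg]; split=> [b x v|w|v w]; first exact: derivableD.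
  by apply: cvgD; [exact: cf|exact: cg].
have DE b x : 'D_v (fun x => f b x + g b x) x = 'D_v (f b) x + 'D_v (g b) x.
  by rewrite (deriveD (df b x v) (dg b x v)).
by under eq_fun do rewrite DE; apply: cvgD; [exact: Df|exact: Dg].
Qed.

Lemma C1_familyM f g : C1_family f -> C1_family g ->
  C1_family (fun b x => f b x * g b x).
Proof.
move=> [df cf Df] [dg cg Dg]; split=> [b x v|w|v w]; first exact: derivableM.
  by apply: cvgM; [exact: cf|exact: cg].
have DE b x : 'D_v (fun x => f b x * g b x) x
    = f b x * 'D_v (g b) x + g b x * 'D_v (f b) x.
  by rewrite (deriveM (df b x v) (dg b x v)).
under eq_fun do rewrite DE.
by apply: cvgD; apply: cvgM; [exact: cf|exact: Dg|exact: cg|exact: Df].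
Qed.

Lemma C1_family_sum (I : Type) (r : seq I) (f : I -> R -> V -> R) :
  (forall i, C1_family (f i)) -> C1_family (fun b x => \sum_(i <- r) f i b x).
Proof.
move=> Cf; elim: r => [|i r IHr].
  have -> : (fun b x => \sum_(i <- [::]) f i b x) = (fun _ _ => 0).
    by apply/funext => b; apply/funext => x; rewrite big_nil.
  by apply: (@C1_family_param (fun=> 0)) => x; exact: cvg_cst.
have -> : (fun b x => \sum_(j <- i :: r) f j b x)
    = (fun b x => f i b x + \sum_(j <- r) f j b x).
  by apply/funext => b; apply/funext => x; rewrite big_cons.
exact: C1_familyD.
Qed.

Lemma C1_family_prod (I : Type) (r : seq I) (f : I -> R -> V -> R) :
  (forall i, C1_family (f i)) -> C1_family (fun b x => \prod_(i <- r) f i b x).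
Proof.
move=> Cf; elim: r => [|i r IHr].
  have -> : (fun b x => \prod_(i <- [::]) f i b x) = (fun _ _ => 1).
    by apply/funext => b; apply/funext => x; rewrite big_nil.
  by apply: (@C1_family_param (fun=> 1)) => x; exact: cvg_cst.
have -> : (fun b x => \prod_(j <- i :: r) f j b x)
    = (fun b x => f i b x * \prod_(j <- r) f j b x).
  by apply/funext => b; apply/funext => x; rewrite big_cons.
exact: C1_familyM.
Qed.

Lemma C1_family_det n (A : R -> V -> 'M[R]_n) :
  (forall i j, C1_family (fun b x => A b x i j)) ->
  C1_family (fun b x => \det (A b x)).
Proof.
move=> CA; apply: C1_family_sum => s; apply: C1_familyM.
  by apply: (@C1_family_param (fun=> _)) => x; exact: cvg_cst.
by apply: C1_family_prod => i; exact: CA.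
Qed.

Lemma C1_family_const (h : V -> R) : smooth h -> C1_family (fun _ => h).
Proof.
move=> sh; have ch := smooth_continuous sh.
split=> [b x v|w|v w]; first exact: smooth_derivable.
  by apply: (continuous_cvg _ (ch w.2)); exact: cvg_snd.
have c := smooth_continuous (smooth_derive v sh).
by apply: (continuous_cvg _ (c w.2)); exact: cvg_snd.
Qed.

End C1Family.

Lemma smooth_coord {R : realType} {V : normedModType R} {m n : nat}
    (f : V -> 'M[R]_(m, n)) i j : smooth f -> smooth (fun x => f x i j).
Proof.
move=> sf k; elim: k f sf => [|k IHk] f sf.
  have cf := smooth_continuous sf => x.
  exact: (continuous_cvg _ (@coord_continuous _ _ _ i j (f x)) (cf x)).
split=> [x|v].
  apply: (@differentiable_comp _ _ _ _ f (fun A : 'M[R]_(m, n) => A i j)).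
    exact: smooth_differentiable.
  exact: differentiable_coord.
have -> : (fun x => 'D_v (fun y => f y i j) x) = (fun x => ('D_v f x) i j).
  by apply/funext => x; rewrite (derive_mx (smooth_derivable sf)) mxE.
exact/IHk/smooth_derive.
Qed.

Section Potential.
Context {R : realType} {d n : nat}.
Context (M : 'M[R]_d) (Mz : 'M[R]_n) (beta : R) (xi : 'cV[R]_d -> 'cV[R]_n).
Hypotheses (hM : spd M) (hMz : spd Mz) (sxi : smooth xi).

(** Polynomial in [b], so it makes sense for negative [b] too and [b = 0] is an interior point of
    the parameter space. *)
Definition gram (b : R) (q : 'cV[R]_d) : 'M[R]_n :=
  Gmx M xi q + b ^+ 2 *: invmx Mz.

(* With b = 1 / nu this is Vfix_nu up to an additive constant, and it extends
   continuously to b = 0. *)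
Definition Vgram (b : R) (q : 'cV[R]_d) : R :=
  (2 * beta)^-1 * ln (\det (gram b q)).

Lemma Vgram0 : Vgram 0 = Vfix M beta xi.
Proof. by apply/funext => q; rewrite /Vgram /gram expr0n scale0r addr0. Qed.

Lemma gram_spd b q : b != 0 -> spd (gram b q).
Proof.
move=> b0; apply: spd_gramD; [exact: spd_invmx|exact: spd_invmx|].
by rewrite exprn_even_gt0.
Qed.

Lemma gram_spd_rank b q : \rank (nabla xi q) = n -> spd (gram b q).
Proof.
move=> rq; have [->|b0] := eqVneq b 0; last exact: gram_spd.
rewrite /gram expr0n scale0r addr0; apply: spd_gram => //.
exact: spd_invmx.
Qed.

(** Once [M] is factored out, Sylvester's identity passes from size [d] to size [n], where [nu ^+ 2]
    and [Mz] factor out in turn. *)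
Lemma det_Mnu (nu : R) q : nu != 0 ->
  \det (Mnu M Mz xi nu q) =
  \det M * (nu ^+ 2) ^+ n * \det Mz * \det (gram nu^-1 q).
Proof.
move=> nu0; have uM := spd_unitmx hM; have uMz := spd_unitmx hMz.
set J := nabla xi q.
have -> : Mnu M Mz xi nu q =
    M *m (1%:M + (nu ^+ 2 *: invmx M *m J *m Mz) *m J^T).
  rewrite mulmxDr mulmx1 /Mnu -/J -!scalemxAl -scalemxAr; congr (_ + _ *: _).
  by rewrite !mulmxA mulmxV// mul1mx.
rewrite det_mulmx det_1D_mulmx_comm.
have -> : 1%:M + J^T *m (nu ^+ 2 *: invmx M *m J *m Mz) =
    nu ^+ 2 *: (gram nu^-1 q *m Mz).
  rewrite /gram mulmxDl -(scalemxAl (nu^-1 ^+ 2)) mulVmx// scalerDr scalerA.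
  rewrite exprVn divff ?expf_neq0//.
  by rewrite scale1r addrC -!scalemxAl -scalemxAr /Gmx -/J !mulmxA.
by rewrite detZ det_mulmx -!mulrA [\det Mz * _]mulrC.
Qed.

Lemma Vfix_nuE (nu : R) : nu != 0 -> exists c : R,
  forall q, Vfix_nu M Mz beta xi nu q = c + Vgram nu^-1 q.
Proof.
move=> nu0; exists ((2 * beta)^-1 * ln (\det M * (nu ^+ 2) ^+ n * \det Mz)).
move=> q; rewrite /Vfix_nu det_Mnu// lnM ?mulrDr// posrE.
  by rewrite !mulr_gt0 ?det_spd_gt0// exprn_gt0// exprn_even_gt0.
by apply/det_spd_gt0/gram_spd; rewrite invr_eq0.
Qed.

Lemma C1_family_det_gram : C1_family (fun b q => \det (gram b q)).
Proof.
apply: C1_family_det => i j.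
have CJ k l : C1_family (fun b q => nabla xi q k l).
  apply: C1_family_const.
  rewrite (_ : (fun q => _) = (fun q => ('D_(delta_mx k 0) xi q) l 0)).
    exact/smooth_coord/smooth_derive.
  by apply/funext => q; rewrite nablaE.
have Cc (c : R) : C1_family (fun (_ : R) (_ : 'cV[R]_d) => c).
  by apply: (@C1_family_param _ _ (fun=> c)) => x; exact: cvg_cst.
rewrite (_ : (fun b q => _) = (fun b q => \sum_k (\sum_l nabla xi q l i *
    invmx M l k) * nabla xi q k j + b ^+ 2 * invmx Mz i j)).
  apply: C1_familyD.
    apply: C1_family_sum => k; apply: C1_familyM => //.
    by apply: C1_family_sum => l; exact: C1_familyM.
  apply: (@C1_family_param _ _ (fun b => b ^+ 2 * invmx Mz i j)) => b.
  by apply: cvgM; [exact: exprn_continuous|exact: cvg_cst].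
apply/funext => b; apply/funext => q; rewrite !mxE; congr (_ + _).
apply: eq_bigr => k _; rewrite !mxE; congr (_ * _).
by apply: eq_bigr => l _; rewrite !mxE.
Qed.

Lemma derive_Vgram b q v : 0 < \det (gram b q) ->
  is_derive q v (Vgram b)
    ((2 * beta)^-1 *
     ((\det (gram b q))^-1 * 'D_v (fun q => \det (gram b q)) q)).
Proof.
move=> g0; have [dg _ _] := C1_family_det_gram.
have := is_derive_ln (dg b q v) g0.
exact: is_deriveZ.
Qed.

Lemma grad_VgramE b q j k : 0 < \det (gram b q) ->
  grad (Vgram b) q j k = (2 * beta)^-1 *
    ((\det (gram b q))^-1 * 'D_(delta_mx j 0) (fun q => \det (gram b q)) q).
Proof.
move=> g0; have [_ DE] := derive_Vgram (delta_mx j 0) g0.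
by rewrite mxE DE.
Qed.

Section Limits.
Context {T : Type} {F : set_system T} {FF : Filter F}.
Variables (b_ : T -> R) (q_ : T -> 'cV[R]_d) (b : R) (q : 'cV[R]_d).
Hypotheses (bb : b_ @ F --> b) (qq : q_ @ F --> q).

Lemma cvg_Gmx : Gmx M xi (q_ t) @[t --> F] --> Gmx M xi q.
Proof.
have JJ : nabla xi (q_ t) @[t --> F] --> nabla xi q by exact: cvg_nabla.
exact: (cvg_mulmx (cvg_mulmx (cvg_trmx JJ) (cvg_cst _)) JJ).
Qed.

Lemma cvg_gram : gram (b_ t) (q_ t) @[t --> F] --> gram b q.
Proof.
apply: cvgD; first exact: cvg_Gmx.
by apply: cvgZ; [exact: (cvgM bb bb)|exact: cvg_cst].
Qed.

Lemma cvg_grad_Vgram : 0 < \det (gram b q) ->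
  grad (Vgram (b_ t)) (q_ t) @[t --> F] --> grad (Vgram b) q.
Proof.
move=> g0.
have gg : \det (gram (b_ t) (q_ t)) @[t --> F] --> \det (gram b q).
  exact/cvg_det/cvg_gram.
have gt : \forall t \near F, 0 < \det (gram (b_ t) (q_ t)).
  exact: cvgr_gt gg _ g0.
have [_ _ Dg] := C1_family_det_gram.
apply/cvg_mxP => j k.
(* Rewrites the limit alone: along the filter the explicit formula holds only eventually, where the
   determinant is positive. *)
apply: (eq_ind_r (fun L : R => grad (Vgram (b_ t)) (q_ t) j k @[t --> F] --> L)
  _ (grad_VgramE j k g0)).
have : (2 * beta)^-1 * ((\det (gram (b_ t) (q_ t)))^-1 *
    'D_(delta_mx j 0) (fun q => \det (gram (b_ t) q)) (q_ t)) @[t --> F] -->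
    (2 * beta)^-1 * ((\det (gram b q))^-1 *
    'D_(delta_mx j 0) (fun q => \det (gram b q)) q).
  apply: cvgM; first exact: cvg_cst.
  apply: cvgM; first by apply: cvgV => //; rewrite gt_eqF.
  pose D (b : R) (q : 'cV[R]_d) :=
    'D_(delta_mx j 0) (fun q => \det (gram b q)) q.
  have cD : D w.1 w.2 @[w --> (b, q)] --> D b q := Dg _ (b, q).
  exact: (continuous2_cvg _ cD bb qq).
apply: cvg_trans; apply: near_eq_cvg; apply: filterS gt => t gt.
by rewrite (grad_VgramE _ _ gt).
Qed.

End Limits.

End Potential.

(** * The family of schemes *)

Section StateLimits.
Context {R : realType} {d n : nat} {T : Type} {F : set_system T} {FF : Filter F}.

Lemma cvg_fst_app {V W : topologicalType} (f : T -> V * W) (l : V * W) :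
  f @ F --> l -> (f t).1 @[t --> F] --> l.1.
Proof. by move=> fl; apply: (cvg_comp _ _ fl); exact: cvg_fst. Qed.

Lemma cvg_snd_app {V W : topologicalType} (f : T -> V * W) (l : V * W) :
  f @ F --> l -> (f t).2 @[t --> F] --> l.2.
Proof. by move=> fl; apply: (cvg_comp _ _ fl); exact: cvg_snd. Qed.

Lemma cvg_quad {A B C D : topologicalType} (f1 : T -> A) (f2 : T -> B)
    (f3 : T -> C) (f4 : T -> D)
    (a1 : A) (a2 : B) (a3 : C) (a4 : D) :
  f1 @ F --> a1 -> f2 @ F --> a2 -> f3 @ F --> a3 -> f4 @ F --> a4 ->
  (f1 t, f2 t, f3 t, f4 t) @[t --> F] --> (a1, a2, a3, a4).
Proof. by move=> h1 h2 h3 h4; exact: (cvg_pair (cvg_pair (cvg_pair h1 h2) h3) h4). Qed.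

Variables (x_ : T -> state R d n) (x : state R d n).
Hypothesis xx : x_ @ F --> x.

Lemma cvg_posq : posq (x_ t) @[t --> F] --> posq x.
Proof. exact: (cvg_fst_app (cvg_fst_app (cvg_fst_app xx))). Qed.

Lemma cvg_posz : posz (x_ t) @[t --> F] --> posz x.
Proof. exact: (cvg_snd_app (cvg_fst_app (cvg_fst_app xx))). Qed.

Lemma cvg_momp : momp (x_ t) @[t --> F] --> momp x.
Proof. exact: (cvg_snd_app (cvg_fst_app xx)). Qed.

Lemma cvg_mompz : mompz (x_ t) @[t --> F] --> mompz x.
Proof. exact: (cvg_snd_app xx). Qed.

End StateLimits.

Section PartialGradients.
Context {R : realType} {d n : nat} (U : 'cV[R]_d -> 'cV[R]_n -> R).
Let Uc := fun w : 'cV[R]_d * 'cV[R]_n => U w.1 w.2.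
Hypothesis sU : smooth Uc.

Let pair_scaleD (a a' : 'cV[R]_d) (b b' : 'cV[R]_n) (h : R) :
  h *: (a, b) + (a', b') = (h *: a + a', h *: b + b').
Proof. by []. Qed.

Lemma derive_U1 q z v :
  'D_v (fun q => U q z) q = 'D_((v, 0) : 'cV[R]_d * 'cV[R]_n) Uc (q, z).
Proof.
apply: (@derive_comp_affine _ _ _ _ Uc (fun q => (q, z))) => h.
by rewrite pair_scaleD scaler0 add0r.
Qed.

Lemma derivable_U1 q z v : derivable (fun q => U q z) q v.
Proof.
apply: (@derivable_comp_affine _ _ _ _ Uc (fun q => (q, z)) q v (v, 0)) => [h|].
  by rewrite pair_scaleD scaler0 add0r.
exact: smooth_derivable.
Qed.

Lemma derive_U2 q z v :
  'D_v (U q) z = 'D_((0, v) : 'cV[R]_d * 'cV[R]_n) Uc (q, z).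
Proof.
apply: (@derive_comp_affine _ _ _ _ Uc (fun z => (q, z))) => h.
by rewrite pair_scaleD scaler0 add0r.
Qed.

(** Explains the factor [1 / a] in the force on the momentum [p^z]: the potential sees [z] through
    [z / a]. *)
Lemma derive_U2_scale q z v (c : R) :
  'D_v (fun z => U q (c *: z)) z = c * 'D_v (U q) (c *: z).
Proof.
have dU := smooth_differentiable (q, c *: z) sU.
have pE h : (q, c *: (h *: v + z)) =
    h *: (c *: ((0, v) : 'cV[R]_d * 'cV[R]_n)) + (q, c *: z).
  have -> : c *: ((0, v) : 'cV[R]_d * 'cV[R]_n) = (0, c *: v).
    by rewrite -[LHS]/(c *: 0, c *: v) scaler0.
  by rewrite pair_scaleD scaler0 add0r scalerDr !scalerA mulrC.
rewrite derive_U2.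
rewrite (@derive_comp_affine _ _ _ _ Uc (fun z => (q, c *: z)) z v _ pE).
by rewrite !deriveE// linearZ.
Qed.

Section Limits.
Context {T : Type} {F : set_system T} {FF : Filter F}.
Variables (q_ : T -> 'cV[R]_d) (z_ : T -> 'cV[R]_n) (q : 'cV[R]_d) (z : 'cV[R]_n).
Hypotheses (qq : q_ @ F --> q) (zz : z_ @ F --> z).

Let cvg_derive_U w :
  'D_w Uc (q_ t, z_ t) @[t --> F] --> 'D_w Uc (q, z).
Proof.
have c := smooth_continuous (smooth_derive w sU).
apply: (continuous_cvg _ (c (q, z))).
exact: (cvg_pair qq zz).
Qed.

Lemma cvg_grad_U1 :
  grad (fun q => U q (z_ t)) (q_ t) @[t --> F] --> grad (fun q => U q z) q.
Proof.
apply/cvg_mxP => i j; rewrite mxE derive_U1.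
by under eq_fun do rewrite mxE derive_U1; exact: cvg_derive_U.
Qed.

Lemma cvg_grad_U2 : grad (U (q_ t)) (z_ t) @[t --> F] --> grad (U q) z.
Proof.
apply/cvg_mxP => i j; rewrite mxE derive_U2.
by under eq_fun do rewrite mxE derive_U2; exact: cvg_derive_U.
Qed.

End Limits.

End PartialGradients.

Section Step.
Context {R : realType} {d n : nat}.
Context (M : 'M[R]_d) (Mz : 'M[R]_n) (beta dt : R).
Context (U : 'cV[R]_d -> 'cV[R]_n -> R) (xi : 'cV[R]_d -> 'cV[R]_n).
Hypotheses (hM : spd M) (hMz : spd Mz) (hdt : 0 < dt).
Hypotheses (sU : smooth (fun w : 'cV[R]_d * 'cV[R]_n => U w.1 w.2)).
Hypothesis (sxi : smooth xi).

Local Notation gram := (gram M Mz xi).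
Local Notation Vgram := (Vgram M Mz beta xi).

(* The parameters (a, b) of the scheme. *)
Implicit Types (c : R * R) (x y : state R d n) (l : 'cV[R]_n).

Definition step_rel c x y := step M Mz U xi dt c.1 c.2 (Vgram c.2) x y.

Definition half_p c x l := p_half U xi dt c.1 (Vgram c.2) x l.
Definition half_pz c x l := pz_half U dt c.1 c.2 x l.
Definition new_q c x l := q_next M U xi dt c.1 (Vgram c.2) x l.
Definition new_z c x l := z_next Mz U dt c.1 c.2 x l.

(* End-of-step momenta before the projection by the second multiplier. *)
Definition free_p c x l := half_p c x l -
  (dt / 2) *: (grad (fun q => U q (c.1^-1 *: new_z c x l)) (new_q c x l)
               + grad (Vgram c.2) (new_q c x l)).
Definition free_pz c x l := half_pz c x l -
  (dt / (2 * c.1)) *: grad (U (new_q c x l)) (c.1^-1 *: new_z c x l).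

Definition second_mult c x l := invmx (gram c.2 (new_q c x l)) *m
  ((nabla xi (new_q c x l))^T *m invmx M *m free_p c x l
   - c.2 *: (invmx Mz *m free_pz c x l)).

Definition new_state c x l : state R d n :=
  (new_q c x l, new_z c x l,
   free_p c x l - nabla xi (new_q c x l) *m second_mult c x l,
   free_pz c x l + c.2 *: second_mult c x l).

Definition residual c x l := xi (new_q c x l) - c.2 *: new_z c x l.

(* new_q c x l = new_q c x 0 - dt M^-1 J l is solved for l. *)
Definition first_mult c x y := dt^-1 *:
  (invmx (Gmx M xi (posq x)) *m
   ((nabla xi (posq x))^T *m (new_q c x 0 - posq y))).

Lemma new_qE c x l :
  new_q c x l = new_q c x 0 - dt *: (invmx M *m nabla xi (posq x)) *m l.
Proof.
rewrite /new_q /q_next /p_half mulmx0 subr0 mulmxBr scalerBr [LHS]addrA.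
by rewrite -[in RHS]scalemxAl -[in RHS]mulmxA.
Qed.

Lemma new_zE c x l :
  new_z c x l = new_z c x 0 + (dt * c.2) *: (invmx Mz *m l).
Proof.
rewrite /new_z /z_next /pz_half scaler0 addr0 mulmxDr scalerDr [LHS]addrA.
by rewrite -[in LHS]scalemxAr scalerA.
Qed.

(** [new_q] is affine in [l] with linear part [- dt M^-1 J], and applying [J^T] turns this into
    [- dt G]. The multiplier thus becomes a function of the pair [(x, y)], so that uniqueness of [l]
    near [l0] yields uniqueness of [y] near [y0]. *)
Lemma first_mult_new_q c x y l : Gmx M xi (posq x) \in unitmx ->
  posq y = new_q c x l -> first_mult c x y = l.
Proof.
move=> uG yE; rewrite /first_mult yE (new_qE _ _ l) subKr.
rewrite -scalemxAl -!scalemxAr scalerA mulVf ?gt_eqF// scale1r.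
rewrite !mulmxA -(mulmxA _ (_^T)) -(mulmxA _ (_^T *m _)) -/(Gmx M xi (posq x)).
by rewrite mulVmx// mul1mx.
Qed.

(** Both momenta are affine in [mu]: [p] contributes [J^T M^-1 J mu] and [p^z] contributes
    [b^2 Mz^-1 mu], one [b] from its update and one from the constraint. Their sum is [gram] applied
    to [mu]. *)
Lemma velocity_constraint c x l mu : gram c.2 (new_q c x l) \in unitmx ->
  (nabla xi (new_q c x l))^T *m invmx M *m
    (free_p c x l - nabla xi (new_q c x l) *m mu) =
  c.2 *: (invmx Mz *m (free_pz c x l + c.2 *: mu)) <->
  mu = second_mult c x l.
Proof.
rewrite /second_mult => ug; set J := nabla xi _ in ug *.
set p := free_p _ _ _; set pz := free_pz _ _ _.
have moveE (A B C D : 'cV[R]_n) : A - B = C + D <-> B + D = A - C.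
  by split=> /matrixP E; apply/matrixP => i j; have := E i j; rewrite !mxE; lra.
have gE : gram c.2 (new_q c x l) *m mu =
    J^T *m invmx M *m (J *m mu) + c.2 *: (invmx Mz *m (c.2 *: mu)).
  by rewrite mulmxDl mulmxA -scalemxAl -scalemxAr scalerA -expr2.
split=> E.
  have <- : gram c.2 (new_q c x l) *m mu =
      J^T *m invmx M *m p - c.2 *: (invmx Mz *m pz).
    by rewrite gE; apply/moveE; rewrite -mulmxBr E mulmxDr scalerDr.
  by rewrite mulKmx.
have : gram c.2 (new_q c x l) *m mu =
    J^T *m invmx M *m p - c.2 *: (invmx Mz *m pz) by rewrite E mulKVmx.
by rewrite gE => /moveE {}E; rewrite mulmxBr E -scalerDr -mulmxDr.
Qed.

Lemma step_relP c x y : Gmx M xi (posq x) \in unitmx ->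
  gram c.2 (posq y) \in unitmx -> step_rel c x y ->
  residual c x (first_mult c x y) = 0 /\ y = new_state c x (first_mult c x y).
Proof.
move=> uG ug [l [mu [yq yz yp ypz [cq cp]]]].
have <- : l = first_mult c x y by rewrite (first_mult_new_q uG yq).
have yq' : posq y = new_q c x l := yq.
have yz' : posz y = new_z c x l := yz.
split; first by rewrite /residual -yq' -yz' cq subrr.
have muE : mu = second_mult c x l.
  apply/velocity_constraint; first by rewrite -yq'.
  by rewrite /free_p /free_pz -yq' -yz' -yp -ypz.
case: y yq' yz' yp ypz {cq cp ug yq yz} => [[[q z] p] pz].
rewrite /posq /posz /momp /mompz/= => -> -> -> ->.
by rewrite /new_state -muE.
Qed.

Lemma new_state_step c x l : gram c.2 (new_q c x l) \in unitmx ->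
  residual c x l = 0 -> step_rel c x (new_state c x l).
Proof.
move=> ug /subr0_eq r0; exists l, (second_mult c x l); split=> //.
by split=> //; exact/velocity_constraint.
Qed.

(** At [b = 0] only [xi] composed with the affine map [new_q] remains; the outer transpose is there
    because [nabla] is the transposed Jacobian. *)
Lemma wellposed_jacobian c x l : c.2 = 0 ->
  nabla (fun l => xi (q_next M U xi dt c.1 (Vgram c.2) x l)
                  - c.2 *: z_next Mz U dt c.1 c.2 x l) l =
  (- dt *: ((nabla xi (new_q c x l))^T *m (invmx M *m nabla xi (posq x))))^T.
Proof.
move=> c0; set K := invmx M *m _.
apply/matrixP => j i; rewrite !mxE.
have -> : (fun l => (xi (q_next M U xi dt c.1 (Vgram c.2) x l)
    - c.2 *: z_next Mz U dt c.1 c.2 x l) i 0) = (fun l => xi (new_q c x l) i 0).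
  by apply/funext => l'; rewrite [X in X *: _]c0 scale0r subr0.
have affE (u : 'cV[R]_n) h :
    new_q c x (h *: u + l) = h *: (- dt *: (K *m u)) + new_q c x l.
  rewrite new_qE (new_qE _ _ l) mulmxDr -!scalemxAl -scalemxAr.
  move: (new_q c x 0) (K *m u) (K *m l) => w0 v1 v2.
  by apply/matrixP => r s; rewrite !mxE; ring.
rewrite (@derive_comp_affine _ _ _ _ (fun q => xi q i 0) _ _ _ _ (affE (delta_mx j 0))).
rewrite derive_coord// derive_nabla//.
rewrite -scalemxAr mulmxA mxE; congr (_ * _).
by rewrite -colE mxE mxE.
Qed.

Section Limits.
Context {T : Type} {F : set_system T} {FF : Filter F}.
Variables (c_ : T -> R * R) (x_ : T -> state R d n) (l_ : T -> 'cV[R]_n).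
Variables (c : R * R) (x : state R d n) (l : 'cV[R]_n).
Hypotheses (cc : c_ @ F --> c) (xx : x_ @ F --> x) (ll : l_ @ F --> l).
Hypotheses (a0 : c.1 != 0) (g0 : 0 < \det (gram c.2 (posq x))).

Let aV : (c_ t).1^-1 @[t --> F] --> c.1^-1.
Proof. by apply: cvgV => //; exact: (cvg_fst_app cc). Qed.

Let bb : (c_ t).2 @[t --> F] --> c.2.
Proof. exact: (cvg_snd_app cc). Qed.

Let qq : posq (x_ t) @[t --> F] --> posq x.
Proof. exact: cvg_posq. Qed.

Let az : (c_ t).1^-1 *: posz (x_ t) @[t --> F] --> c.1^-1 *: posz x.
Proof. by apply: cvgZ => //; exact: cvg_posz. Qed.

Let dta : dt / (2 * (c_ t).1) @[t --> F] --> dt / (2 * c.1).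
Proof.
rewrite invfM; under eq_fun do rewrite invfM.
by apply: cvgM; [exact: cvg_cst|apply: cvgM => //; exact: cvg_cst].
Qed.

Lemma cvg_half_p : half_p (c_ t) (x_ t) (l_ t) @[t --> F] --> half_p c x l.
Proof.
have h1 : momp (x_ t) @[t --> F] --> momp x by exact: cvg_momp.
have h2 : grad (fun q => U q ((c_ t).1^-1 *: posz (x_ t))) (posq (x_ t))
    @[t --> F] --> grad (fun q => U q (c.1^-1 *: posz x)) (posq x).
  exact: cvg_grad_U1.
have h3 : grad (Vgram (c_ t).2) (posq (x_ t)) @[t --> F] -->
    grad (Vgram c.2) (posq x) by exact: cvg_grad_Vgram.
have h4 : nabla xi (posq (x_ t)) @[t --> F] --> nabla xi (posq x).
  exact: cvg_nabla.
exact: (cvgB (cvgB h1 (cvgZ (cvg_cst _) (cvgD h2 h3))) (cvg_mulmx h4 ll)).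
Qed.

Lemma cvg_half_pz : half_pz (c_ t) (x_ t) (l_ t) @[t --> F] --> half_pz c x l.
Proof.
have h1 : mompz (x_ t) @[t --> F] --> mompz x by exact: cvg_mompz.
have h2 : grad (U (posq (x_ t))) ((c_ t).1^-1 *: posz (x_ t)) @[t --> F] -->
    grad (U (posq x)) (c.1^-1 *: posz x) by exact: cvg_grad_U2.
exact: (cvgD (cvgB h1 (cvgZ dta h2)) (cvgZ bb ll)).
Qed.

Lemma cvg_new_q : new_q (c_ t) (x_ t) (l_ t) @[t --> F] --> new_q c x l.
Proof.
exact: (cvgD qq (cvgZ (cvg_cst _) (cvg_mulmx (cvg_cst _) cvg_half_p))).
Qed.

Lemma cvg_new_z : new_z (c_ t) (x_ t) (l_ t) @[t --> F] --> new_z c x l.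
Proof.
have h1 : posz (x_ t) @[t --> F] --> posz x by exact: cvg_posz.
exact: (cvgD h1 (cvgZ (cvg_cst _) (cvg_mulmx (cvg_cst _) cvg_half_pz))).
Qed.

Lemma cvg_residual :
  residual (c_ t) (x_ t) (l_ t) @[t --> F] --> residual c x l.
Proof.
have h1 : xi (new_q (c_ t) (x_ t) (l_ t)) @[t --> F] --> xi (new_q c x l).
  have cxi := smooth_continuous sxi.
  exact: (continuous_cvg _ (cxi (new_q c x l)) cvg_new_q).
exact: (cvgB h1 (cvgZ bb cvg_new_z)).
Qed.

Lemma cvg_new_state : 0 < \det (gram c.2 (new_q c x l)) ->
  new_state (c_ t) (x_ t) (l_ t) @[t --> F] --> new_state c x l.
Proof.
move=> g1; have q1 := cvg_new_q; have z1 := cvg_new_z.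
have az1 : (c_ t).1^-1 *: new_z (c_ t) (x_ t) (l_ t) @[t --> F] -->
    c.1^-1 *: new_z c x l by exact: cvgZ.
have h2 : grad (fun q => U q ((c_ t).1^-1 *: new_z (c_ t) (x_ t) (l_ t)))
    (new_q (c_ t) (x_ t) (l_ t)) @[t --> F] -->
    grad (fun q => U q (c.1^-1 *: new_z c x l)) (new_q c x l).
  exact: cvg_grad_U1.
have h3 : grad (Vgram (c_ t).2) (new_q (c_ t) (x_ t) (l_ t)) @[t --> F] -->
    grad (Vgram c.2) (new_q c x l) by exact: cvg_grad_Vgram.
have h4 : grad (U (new_q (c_ t) (x_ t) (l_ t)))
    ((c_ t).1^-1 *: new_z (c_ t) (x_ t) (l_ t)) @[t --> F] -->
    grad (U (new_q c x l)) (c.1^-1 *: new_z c x l) by exact: cvg_grad_U2.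
have J1 : nabla xi (new_q (c_ t) (x_ t) (l_ t)) @[t --> F] -->
    nabla xi (new_q c x l) by exact: cvg_nabla.
have gg : gram (c_ t).2 (new_q (c_ t) (x_ t) (l_ t)) @[t --> F] -->
    gram c.2 (new_q c x l) by exact: cvg_gram.
have ug : gram c.2 (new_q c x l) \in unitmx by rewrite unitmxE unitfE gt_eqF.
have fp : free_p (c_ t) (x_ t) (l_ t) @[t --> F] --> free_p c x l.
  exact: (cvgB cvg_half_p (cvgZ (cvg_cst _) (cvgD h2 h3))).
have fpz : free_pz (c_ t) (x_ t) (l_ t) @[t --> F] --> free_pz c x l.
  exact: (cvgB cvg_half_pz (cvgZ dta h4)).
have mm : second_mult (c_ t) (x_ t) (l_ t) @[t --> F] --> second_mult c x l.
  exact: (cvg_mulmx (cvg_invmx ug gg)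
    (cvgB (cvg_mulmx (cvg_mulmx (cvg_trmx J1) (cvg_cst _)) fp)
          (cvgZ bb (cvg_mulmx (cvg_cst _) fpz)))).
have p1 : free_p (c_ t) (x_ t) (l_ t) -
    nabla xi (new_q (c_ t) (x_ t) (l_ t)) *m second_mult (c_ t) (x_ t) (l_ t)
    @[t --> F] --> free_p c x l - nabla xi (new_q c x l) *m second_mult c x l.
  exact: (cvgB fp (cvg_mulmx J1 mm)).
have pz1 : free_pz (c_ t) (x_ t) (l_ t) +
    (c_ t).2 *: second_mult (c_ t) (x_ t) (l_ t)
    @[t --> F] --> free_pz c x l + c.2 *: second_mult c x l.
  exact: (cvgD fpz (cvgZ bb mm)).
exact: (cvg_quad q1 z1 p1 pz1).
Qed.

End Limits.

Lemma cvg_first_mult {T : Type} {F : set_system T} {FF : Filter F}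
    (c_ : T -> R * R) (x_ y_ : T -> state R d n) c x y :
  c_ @ F --> c -> x_ @ F --> x -> y_ @ F --> y ->
  c.1 != 0 -> 0 < \det (gram c.2 (posq x)) -> Gmx M xi (posq x) \in unitmx ->
  first_mult (c_ t) (x_ t) (y_ t) @[t --> F] --> first_mult c x y.
Proof.
move=> cc xx yy a0 g0 uG.
have h1 : new_q (c_ t) (x_ t) 0 @[t --> F] --> new_q c x 0.
  by apply: cvg_new_q => //; exact: cvg_cst.
have h2 : posq (x_ t) @[t --> F] --> posq x by exact: cvg_posq.
have h3 : posq (y_ t) @[t --> F] --> posq y by exact: cvg_posq.
have h4 : nabla xi (posq (x_ t)) @[t --> F] --> nabla xi (posq x).
  exact: cvg_nabla.
have h5 : Gmx M xi (posq (x_ t)) @[t --> F] --> Gmx M xi (posq x).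
  exact: cvg_Gmx.
exact: (cvgZ (cvg_cst _) (cvg_mulmx (cvg_invmx uG h5)
  (cvg_mulmx (cvg_trmx h4) (cvgB h1 h3)))).
Qed.

End Step.

(** * Local existence and continuity of the flows *)

Section LocalFlow.
Context {R : realType} {d n : nat}.
Context (M : 'M[R]_d) (Mz : 'M[R]_n) (beta dt : R).
Context (U : 'cV[R]_d -> 'cV[R]_n -> R) (xi : 'cV[R]_d -> 'cV[R]_n).
Hypotheses (hM : spd M) (hMz : spd Mz) (hdt : 0 < dt).
Hypotheses (sU : smooth (fun w : 'cV[R]_d * 'cV[R]_n => U w.1 w.2)).
Hypothesis (sxi : smooth xi).

Local Notation gram := (gram M Mz xi).
Local Notation new_q := (new_q M Mz beta dt U xi).
Local Notation new_z := (new_z Mz dt U).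
Local Notation residual := (residual M Mz beta dt U xi).
Local Notation new_state := (new_state M Mz beta dt U xi).
Local Notation first_mult := (first_mult M Mz beta dt U xi).
Local Notation step_rel := (step_rel M Mz beta dt U xi).

Variables (c0 : R * R) (x0 y0 : state R d n).
Hypotheses (a0 : c0.1 != 0) (b0 : c0.2 = 0).
Hypothesis rx0 : \rank (nabla xi (posq x0)) = n.

Let p0 : (R * R) * state R d n := (c0, x0).

Let gx0 : 0 < \det (gram c0.2 (posq x0)).
Proof. by apply/det_spd_gt0/gram_spd_rank. Qed.

Let proj11 (S : topologicalType) (w : (R * R) * state R d n * S) :
  v.1.1 @[v --> w] --> w.1.1.
Proof.
have idw : v @[v --> w] --> w by exact: cvg_id.
exact: (cvg_fst_app (cvg_fst_app idw)).
Qed.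

Let proj12 (S : topologicalType) (w : (R * R) * state R d n * S) :
  v.1.2 @[v --> w] --> w.1.2.
Proof.
have idw : v @[v --> w] --> w by exact: cvg_id.
exact: (cvg_snd_app (cvg_fst_app idw)).
Qed.

Let proj2 (S : topologicalType) (w : (R * R) * state R d n * S) :
  v.2 @[v --> w] --> w.2.
Proof.
have idw : v @[v --> w] --> w by exact: cvg_id.
exact: (cvg_snd_app idw).
Qed.

Let A l0 := - dt *: ((nabla xi (new_q c0 x0 l0))^T *m
  (invmx M *m nabla xi (posq x0))).

(** Positions are affine in [l], so the error splits into that of [xi] at [q1] and a linear term
    [E p *m (l - l')], where [E p] compares the linear part at [p] with [A l0]; it vanishes at [p0]
    because [b = 0] there. *)
Lemma residual_strictly_differentiable (l0 : 'cV[R]_n) (eta : R) :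
  0 < eta -> exists2 r : R, 0 < r &
  \forall p \near p0, forall l l', ball l0 r l -> ball l0 r l' ->
    `|residual p.1 p.2 l - residual p.1 p.2 l' - A l0 *m (l - l')|
    <= eta * `|l - l'|.
Proof.
move=> eta0; set q1 := new_q c0 x0 l0; set J1 := nabla xi q1.
pose K (p : (R * R) * state R d n) := dt *: (invmx M *m nabla xi (posq p.2)).
have idp : p @[p --> p0] --> p0 by exact: cvg_id.
have cJ : nabla xi (posq p.2) @[p --> p0] --> nabla xi (posq x0).
  by apply: cvg_nabla => //; apply: cvg_posq; exact: (cvg_snd_app idp).
have cK : K p @[p --> p0] --> K p0.
  exact: (cvgZ (cvg_cst _) (cvg_mulmx (cvg_cst _) cJ)).
have cb : p.1.2 @[p --> p0] --> c0.2 by exact: (cvg_snd_app (cvg_fst_app idp)).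
pose E (p : (R * R) * state R d n) :=
  - (J1^T *m K p) - (dt * p.1.2 * p.1.2) *: invmx Mz - A l0.
have cE : E p @[p --> p0] --> E p0.
  exact: (cvgB (cvgB (cvgN (cvg_mulmx (cvg_cst _) cK))
    (cvgZ (cvgM (cvgM (cvg_cst _) cb) cb) (cvg_cst _))) (cvg_cst _)).
have E0 : E p0 = 0.
  rewrite /E /p0/= b0 mulr0 scale0r subr0 /A /K/= -/q1 -/J1.
  by rewrite -scalemxAr scaleNr opprK addNr.
have n1 : 0 < n%:R + 1 :> R by rewrite ltr_wpDl.
pose C := `|K p0| + 1.
have C0 : 0 < C by rewrite ltr_wpDl.
(* Half of [eta] goes to [xi] and half to [E]; the divisors compensate the factor [n] of matrix
   products and, for [xi], the bound [C] on [K p]. *)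
pose eta1 := eta / 2 / ((n%:R + 1) * C).
have eta10 : 0 < eta1 by rewrite !divr_gt0// mulr_gt0.
pose eta2 := eta / 2 / (n%:R + 1).
have eta20 : 0 < eta2 by rewrite !divr_gt0.
have [s s0 sd] : exists2 s : R, 0 < s & forall q q', ball q1 s q -> ball q1 s q' ->
    `|xi q - xi q' - J1^T *m (q - q')| <= eta1 * `|q - q'|.
  have := smooth_strictly_differentiable sxi q1 eta10.
  move=> sd; near (0 : R)^'+ => s; exists s; first by near: s; exact: nbhs_right_gt.
  by near: s.
have cq : new_q w.1.1 w.1.2 w.2 @[w --> (p0, l0)] --> q1.
  by apply: cvg_new_q => //; [exact: proj11|exact: proj12|exact: proj2].
have [[N B] [/= Np Bl] NB] := cq _ (nbhsx_ballx q1 s s0).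
have [r r0 Br] := (nbhs_ballP _ _).1 Bl.
exists r => //.
have nK : \forall p \near p0, `|K p| <= C.
  move/cvgrPdist_le : cK => /(_ 1 ltr01); apply: filterS => p Kp.
  rewrite -[K p](subKr (K p0)) (le_trans (ler_normB _ _))// lerD2l.
  by rewrite (le_trans _ Kp).
have nE : \forall p \near p0, `|E p| <= eta2.
  move/cvgrPdist_le : cE => /(_ eta2 eta20); apply: filterS => p.
  by rewrite E0 sub0r normrN.
apply: filterS3 Np nK nE => p Np Kp Ep l l' /Br Bl1 /Br Bl2.
have ql : ball q1 s (new_q p.1 p.2 l) := NB (p, l) (conj Np Bl1).
have ql' : ball q1 s (new_q p.1 p.2 l') := NB (p, l') (conj Np Bl2).
have sdl := sd _ _ ql ql'.
have dq : new_q p.1 p.2 l - new_q p.1 p.2 l' = - (K p *m (l - l')).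
  rewrite new_qE (new_qE _ _ _ _ _ _ _ _ l') -/(K p) mulmxBr.
  by rewrite !opprB addrC addrA subrK.
have dz : new_z p.1 p.2 l - new_z p.1 p.2 l' =
    (dt * p.1.2) *: (invmx Mz *m (l - l')).
  rewrite new_zE (new_zE _ _ _ _ _ l') mulmxBr scalerBr.
  by rewrite opprD addrACA subrr add0r.
have -> : residual p.1 p.2 l - residual p.1 p.2 l' - A l0 *m (l - l') =
    (xi (new_q p.1 p.2 l) - xi (new_q p.1 p.2 l')
     - J1^T *m (new_q p.1 p.2 l - new_q p.1 p.2 l')) + E p *m (l - l').
  have -> : residual p.1 p.2 l - residual p.1 p.2 l' =
      xi (new_q p.1 p.2 l) - xi (new_q p.1 p.2 l')
      - p.1.2 *: (new_z p.1 p.2 l - new_z p.1 p.2 l').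
    rewrite /residual scalerBr !opprB addrACA [RHS]addrACA.
    by congr (_ + _); exact: addrC.
  rewrite dq dz /E; move: (A l0) => A0.
  rewrite !mulmxBl mulNmx mulmxN opprK mulmxA scalerA -scalemxAl.
  rewrite [p.1.2 * _]mulrC.
  move: (xi _ - xi _) (J1^T *m K p *m _) (_ *: (invmx Mz *m _)) (A0 *m _).
  by move=> v1 v2 v3 v4; apply/matrixP => i j; rewrite !mxE; ring.
rewrite (le_trans (ler_normD _ _))// [leRHS](_ : _ =
  eta1 * ((n%:R + 1) * C * `|l - l'|) + (n%:R + 1) * eta2 * `|l - l'|); last first.
  rewrite /eta1 /eta2 (mulrA eta1) -(mulrA (eta / 2) _ ((n%:R + 1) * C)).
  rewrite mulVf ?gt_eqF ?mulr_gt0// mulr1 mulrCA divff ?gt_eqF// mulr1 -mulrDl.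
  by rewrite -splitr.
apply: lerD.
  rewrite (le_trans sdl)// dq normrN; apply: ler_wpM2l; first exact: ltW.
  rewrite (le_trans (normmx_mulmx _ _))// ler_wpM2r// ler_pM ?mulr_ge0//.
  by rewrite lerDl.
rewrite (le_trans (normmx_mulmx _ _))// ler_wpM2r// ler_pM ?mulr_ge0//.
by rewrite lerDl.
Unshelve. all: by end_near. Qed.

Hypothesis ry0 : \rank (nabla xi (posq y0)) = n.
Variables (l0 m0 : 'cV[R]_n).
Hypothesis step0 : is_step M Mz U xi dt c0.1 c0.2 (Vgram M Mz beta xi c0.2)
  x0 l0 m0 y0.
Hypothesis uA : nabla (fun l =>
    xi (q_next M U xi dt c0.1 (Vgram M Mz beta xi c0.2) x0 l)
    - c0.2 *: z_next Mz U dt c0.1 c0.2 x0 l) l0 \in unitmx.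

Let uG : Gmx M xi (posq x0) \in unitmx.
Proof. by apply/spd_unitmx/spd_gram => //; exact: spd_invmx. Qed.

Lemma local_flow : exists X Y : set (state R d n),
  [/\ open_nbhs x0 X, open_nbhs y0 Y,
      \forall c \near c0, forall x, X x -> exists! y, Y y /\ step_rel c x y
    & forall (T : Type) (G : set_system T) (FG : Filter G) (c_ : T -> R * R)
        (x_ y_ : T -> state R d n) x y,
        X x -> Y y -> step_rel c0 x y -> c_ @ G --> c0 -> x_ @ G --> x ->
        (\forall t \near G, Y (y_ t) /\ step_rel (c_ t) (x_ t) (y_ t)) ->
        y_ @ G --> y].
Proof.
have yq : posq y0 = new_q c0 x0 l0 by case: step0.
have L0 : first_mult c0 x0 y0 = l0 by apply: first_mult_new_q.
have gy0 : 0 < \det (gram c0.2 (posq y0)) by apply/det_spd_gt0/gram_spd_rank.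
have ugy0 : gram c0.2 (posq y0) \in unitmx by rewrite unitmxE unitfE gt_eqF.
have S0 : step_rel c0 x0 y0 by exists l0, m0.
have [F0 Y0] := step_relP hdt uG ugy0 S0.
have uA' : A l0 \in unitmx by move: uA; rewrite wellposed_jacobian// unitmx_tr.
(* Open conditions under which the continuity lemmas apply and the second multiplier exists; the two
   determinants are positive at the base point because [xi] has full rank at both ends of the
   step. *)
have good : \forall w \near (p0, l0), [/\ w.1.1.1 != 0,
    0 < \det (gram w.1.1.2 (posq w.1.2))
    & 0 < \det (gram w.1.1.2 (new_q w.1.1 w.1.2 w.2))].
  have h1 : w.1.1.1 @[w --> (p0, l0)] --> c0.1.
    exact: (cvg_fst_app (@proj11 _ (p0, l0))).
  have h2 : w.1.1.2 @[w --> (p0, l0)] --> c0.2.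
    exact: (cvg_snd_app (@proj11 _ (p0, l0))).
  have h3 : posq w.1.2 @[w --> (p0, l0)] --> posq x0.
    exact: (cvg_posq (@proj12 _ (p0, l0))).
  have h4 : new_q w.1.1 w.1.2 w.2 @[w --> (p0, l0)] --> new_q c0 x0 l0.
    by apply: cvg_new_q => //; [exact: proj11|exact: proj12|exact: proj2].
  have h5 : \det (gram w.1.1.2 (posq w.1.2)) @[w --> (p0, l0)] -->
      \det (gram c0.2 (posq x0)) by apply: cvg_det; exact: cvg_gram.
  have h6 : \det (gram w.1.1.2 (new_q w.1.1 w.1.2 w.2)) @[w --> (p0, l0)] -->
      \det (gram c0.2 (new_q c0 x0 l0)) by apply: cvg_det; exact: cvg_gram.
  have k1 : \forall w \near (p0, l0), w.1.1.1 != 0 by exact: cvgr_neq0 h1 a0.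
  have k5 : \forall w \near (p0, l0), 0 < \det (gram w.1.1.2 (posq w.1.2)).
    exact: cvgr_gt h5 _ gx0.
  rewrite -yq in h6.
  have k6 : \forall w \near (p0, l0),
      0 < \det (gram w.1.1.2 (new_q w.1.1 w.1.2 w.2)).
    exact: cvgr_gt h6 _ gy0.
  by apply: filterS3 k1 k5 k6 => w; exact: And3.
rewrite L0 in F0 Y0.
pose F (p : (R * R) * state R d n) l := residual p.1 p.2 l.
pose Y (p : (R * R) * state R d n) l := new_state p.1 p.2 l.
pose L (p : (R * R) * state R d n) y := first_mult p.1 p.2 y.
have SF : \forall w \near (p0, y0), step_rel w.1.1 w.1.2 w.2 ->
    F w.1 (L w.1 w.2) = 0 /\ w.2 = Y w.1 (L w.1 w.2).
  have h1 : \det (Gmx M xi (posq w.1.2)) @[w --> (p0, y0)] -->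
      \det (Gmx M xi (posq x0)).
    apply: cvg_det; apply: cvg_Gmx => //.
    exact: (cvg_posq (@proj12 _ (p0, y0))).
  have h2 : \det (gram w.1.1.2 (posq w.2)) @[w --> (p0, y0)] -->
      \det (gram c0.2 (posq y0)).
    apply: cvg_det; apply: cvg_gram => //; last first.
      exact: (cvg_posq (@proj2 _ (p0, y0))).
    exact: (cvg_snd_app (@proj11 _ (p0, y0))).
  have k1 : \forall w \near (p0, y0), \det (Gmx M xi (posq w.1.2)) != 0.
    by apply: cvgr_neq0 h1 _; rewrite -unitfE -unitmxE.
  have k2 : \forall w \near (p0, y0), 0 < \det (gram w.1.1.2 (posq w.2)).
    exact: cvgr_gt h2 _ gy0.
  apply: filterS2 k1 k2 => w k1 k2.
  have u1 : Gmx M xi (posq w.1.2) \in unitmx by rewrite unitmxE unitfE.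
  have u2 : gram w.1.1.2 (posq w.2) \in unitmx by rewrite unitmxE unitfE gt_eqF.
  by move=> Sw; exact: (step_relP hdt u1 u2 Sw).
have FS : \forall w \near (p0, l0), F w.1 w.2 = 0 ->
    step_rel w.1.1 w.1.2 (Y w.1 w.2).
  apply: filterS good => w [_ _ g1]; apply: new_state_step.
  by rewrite unitmxE unitfE gt_eqF.
have cL : {for (p0, y0), continuous (fun w => L w.1 w.2)}.
  exact: (cvg_first_mult sU sxi (@proj11 _ (p0, y0)) (@proj12 _ (p0, y0))
    (@proj2 _ (p0, y0)) a0 gx0 uG).
have cF : \forall w \near (p0, l0), {for w, continuous (fun w => F w.1 w.2)}.
  apply: filterS good => w [a1 g1 _].
  exact: (cvg_residual sU sxi (@proj11 _ w) (@proj12 _ w) (@proj2 _ w)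
    a1 g1).
have cY : \forall w \near (p0, l0), {for w, continuous (fun w => Y w.1 w.2)}.
  apply: filterS good => w [a1 g1 g2].
  exact: (cvg_new_state sU sxi (@proj11 _ w) (@proj12 _ w) (@proj2 _ w)
    a1 g1 g2).
have dF := residual_strictly_differentiable l0.
exact: (@implicit_relation R (R * R)%type (state R d n) n step_rel F Y L c0 x0 y0
  l0 (A l0) uA' dF L0 F0 (esym Y0) SF FS cL cF cY).
Qed.

End LocalFlow.

(** * Constrained Verlet schemes *)

Section ConstrainedVerletStep.
Context {R : realType}.

Lemma derive_cstD {V W : normedModType R} (f : V -> W) (c : W) x v :
  'D_v (fun y => c + f y) x = 'D_v f x.
Proof.
by rewrite /derive; under eq_fun do rewrite /= opprD addrACA subrr add0r.
Qed.

Lemma derive_quadratic {V : normedModType R} (f : V -> R) x v (B C : R) :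
  (forall h, f (h *: v + x) - f x = h * B + h ^+ 2 * C) -> 'D_v f x = B.
Proof.
move=> fE; apply: cvg_lim => //.
have h0 : h @[h --> (0 : R)^'] --> (0 : R).
  by apply: cvg_within_filter; exact: cvg_id.
have : B + h * C @[h --> (0 : R)^'] --> B + 0 * C.
  by apply: cvgD; [exact: cvg_cst|apply: cvgM => //; exact: cvg_cst].
rewrite mul0r addr0; apply: cvg_trans; apply: near_eq_cvg.
near=> h; rewrite /= fE.
have hn0 : h != 0 by near: h; exact: nbhs_dnbhs_neq.
by rewrite /GRing.scale/=; field.
Unshelve. all: by end_near. Qed.

(** Stated through differences, so that the terms of a Hamiltonian that do not depend on the chosen
    momentum cancel. *)
Lemma grad_quadratic m (A : 'M[R]_m) (f : 'cV[R]_m -> R) p : A^T = A ->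
  (forall p p', f p' - f p = 2^-1 * ((p'^T *m A *m p') 0 0 - (p^T *m A *m p) 0 0)) ->
  grad f p = A *m p.
Proof.
move=> tA fE; apply/matrixP => i j; rewrite mxE [j]ord1 {j}.
pose v : 'cV[R]_m := delta_mx i 0.
apply: (@derive_quadratic _ _ _ _ _ (2^-1 * (v^T *m A *m v) 0 0)) => h.
have vAp : (v^T *m A *m p) 0 0 = (A *m p) i 0.
  by rewrite -mulmxA /v trmx_delta -rowE mxE.
have pAv : (p^T *m A *m v) 0 0 = (A *m p) i 0.
  rewrite -vAp; have <- : (v^T *m A *m p)^T 0 0 = (v^T *m A *m p) 0 0 by rewrite mxE.
  by rewrite !trmx_mul trmxK tA mulmxA.
rewrite fE -/v.
have -> : (h *: v + p)^T *m A *m (h *: v + p) = h ^+ 2 *: (v^T *m A *m v)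
    + h *: (v^T *m A *m p) + (h *: (p^T *m A *m v) + p^T *m A *m p).
  have -> : (h *: v + p)^T = h *: v^T + p^T.
    by apply/matrixP => k l; rewrite !mxE.
  rewrite mulmxDl mulmxDl !mulmxDr -!scalemxAl -!scalemxAr !scalerA.
  by rewrite expr2.
have addE (X Y : 'M[R]_1) : (X + Y) 0 0 = X 0 0 + Y 0 0 by rewrite mxE.
have sclE (k : R) (X : 'M[R]_1) : (k *: X) 0 0 = k * X 0 0 by rewrite mxE.
rewrite !addE !sclE vAp pAv.
by field.
Qed.

Context {d n : nat} (M : 'M[R]_d) (Mz : 'M[R]_n) (dt a b : R).
Context (U : 'cV[R]_d -> 'cV[R]_n -> R) (xi : 'cV[R]_d -> 'cV[R]_n).
Context (W : 'cV[R]_d -> R).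
Hypotheses (hM : spd M) (hMz : spd Mz).
Hypotheses (sU : smooth (fun w : 'cV[R]_d * 'cV[R]_n => U w.1 w.2)).

Local Notation H := (hamiltonian M Mz U a W).
Local Notation g := (fun q z => xi q - b *: z).
Implicit Type x : state R d n.

Lemma dHq_hamiltonian x : (forall v, derivable W (posq x) v) ->
  dHq H x = grad (fun q => U q (a^-1 *: posz x)) (posq x) + grad W (posq x).
Proof.
move=> dW; pose c := 2^-1 * ((momp x)^T *m invmx M *m momp x) 0 0
  + 2^-1 * ((mompz x)^T *m invmx Mz *m mompz x) 0 0.
have HE : (fun q => H (q, posz x, momp x, mompz x)) =
    (fun q => c + (U q (a^-1 *: posz x) + W q)).
  apply/funext => q; rewrite /hamiltonian /posq /posz /momp /mompz/=.
  exact: esym (addrA _ _ _).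
rewrite /dHq HE; apply/matrixP => i j; rewrite !mxE derive_cstD.
by rewrite deriveD//; exact: derivable_U1.
Qed.

Lemma dHz_hamiltonian x :
  dHz H x = a^-1 *: grad (U (posq x)) (a^-1 *: posz x).
Proof.
pose c := 2^-1 * ((momp x)^T *m invmx M *m momp x) 0 0
  + 2^-1 * ((mompz x)^T *m invmx Mz *m mompz x) 0 0 + W (posq x).
have HE : (fun z => H (posq x, z, momp x, mompz x)) =
    (fun z => c + U (posq x) (a^-1 *: z)).
  apply/funext => z; rewrite /hamiltonian /posq /posz /momp /mompz/=.
  exact: addrAC.
rewrite /dHz HE; apply/matrixP => i j; rewrite !mxE derive_cstD.
exact: derive_U2_scale.
Qed.

Lemma dHp_hamiltonian x : dHp H x = invmx M *m momp x.
Proof.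
apply: grad_quadratic => [|p p']; first by case: (spd_invmx hM).
rewrite /hamiltonian /posq /posz /momp /mompz/=.
by ring.
Qed.

Lemma dHpz_hamiltonian x : dHpz H x = invmx Mz *m mompz x.
Proof.
apply: grad_quadratic => [|p p']; first by case: (spd_invmx hMz).
rewrite /hamiltonian /posq /posz /momp /mompz/=.
by ring.
Qed.

Lemma dgq_constraint x : dgq g x = nabla xi (posq x).
Proof.
have gE j : (fun q => (xi q - b *: posz x) j 0) =
    (fun q => - (b *: posz x) j 0 + xi q j 0).
  by apply/funext => q; rewrite addrC !mxE.
by apply/matrixP => i j; rewrite !mxE gE derive_cstD.
Qed.

Lemma dgz_constraint x : dgz g x = (- b)%:M.
Proof.
apply/matrixP => i j; rewrite !mxE.
apply: (@derive_quadratic _ _ _ _ _ 0) => h; rewrite !mxE eqxx andbT [j == i]eq_sym.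
by case: eqP => _ /=; ring.
Qed.

(** The constraint has derivative [- b] in [z], which turns [- dgz *m lam] into [+ b *: lam].
    Derivability of [W] at the end point is asked under the position constraint, which both forms of
    a step contain: for [Vfix] it is obtained from the full rank of [xi] on the slow manifold. *)
Lemma step_constrained_verlet x y :
  (forall v, derivable W (posq x) v) ->
  (xi (posq y) = b *: posz y -> forall v, derivable W (posq y) v) ->
  step M Mz U xi dt a b W x y <-> constrained_verlet dt H g x y.
Proof.
move=> Wx Wy.
have dtE (v : 'cV[R]_n) : (dt / 2) *: (a^-1 *: v) = (dt / (2 * a)) *: v.
  by rewrite scalerA invfM mulrA.
have dgzE (w : state R d n) l : dgz g w *m l = - (b *: l).
  by rewrite dgz_constraint mul_scalar_mx scaleNr.
have dgzT (w : state R d n) (l : 'cV[R]_n) : (dgz g w)^T *m l = - (b *: l).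
  by rewrite dgz_constraint tr_scalar_mx mul_scalar_mx scaleNr.
split=> [[l [mu [yq yz yp ypz [cq cp]]]]|].
  exists l, mu, (p_half U xi dt a W x l), (pz_half U dt a b x l) => xh yh.
  have dHqy := dHq_hamiltonian (x := yh) (Wy cq).
  split.
  - rewrite dHq_hamiltonian// dHz_hamiltonian dtE dgq_constraint dgzE opprK.
    by split.
  - by rewrite dHp_hamiltonian dHpz_hamiltonian.
  - by rewrite cq subrr.
  - by rewrite dHqy dHz_hamiltonian dtE dgq_constraint dgzE opprK.
  - rewrite dgq_constraint dHp_hamiltonian dHpz_hamiltonian dgzT mulmxA cp.
    by rewrite subrr.
move=> [l [mu [ph [pzh [[phE pzhE] [yq yz] cq [yp ypz] cp]]]]].
have cq' : xi (posq y) = b *: posz y by apply/eqP; rewrite -subr_eq0 cq.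
have dHqy := @dHq_hamiltonian (posq y, posz y, ph, pzh) (Wy cq').
rewrite dHq_hamiltonian// dgq_constraint in phE.
rewrite dHz_hamiltonian dtE dgzE opprK in pzhE.
rewrite dHp_hamiltonian in yq; rewrite dHpz_hamiltonian in yz.
rewrite dHqy dgq_constraint in yp.
rewrite dHz_hamiltonian dtE dgzE opprK in ypz.
rewrite dgq_constraint dHp_hamiltonian dHpz_hamiltonian dgzT mulmxA in cp.
exists l, mu; split.
- by rewrite /q_next /p_half -phE.
- by rewrite /z_next /pz_half -pzhE.
- by rewrite /p_half -phE.
- by rewrite /pz_half -pzhE.
- by split=> //; apply/eqP; rewrite -subr_eq0 cp.
Qed.

End ConstrainedVerletStep.

(** * Derivatives of the Fixman potentials *)

Section FixmanPotential.
Context {R : realType} {d n : nat}.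
Context (M : 'M[R]_d) (Mz : 'M[R]_n) (beta : R) (xi : 'cV[R]_d -> 'cV[R]_n).
Hypotheses (hM : spd M) (hMz : spd Mz) (sxi : smooth xi).

Lemma derivable_Vgram b q v : 0 < \det (gram M Mz xi b q) ->
  derivable (Vgram M Mz beta xi b) q v.
Proof. by move=> g0; have [] := derive_Vgram beta sxi v g0. Qed.

Lemma derivable_Vfix_nu (nu : R) q v : nu != 0 ->
  derivable (Vfix_nu M Mz beta xi nu) q v.
Proof.
move=> nu0; have [c cE] := Vfix_nuE beta xi hM hMz nu0.
rewrite (funext cE); apply: derivableD; first exact: derivable_cst.
by apply/derivable_Vgram/det_spd_gt0/gram_spd => //; rewrite invr_eq0.
Qed.

Lemma derivable_Vfix q v : \rank (nabla xi q) = n ->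
  derivable (Vfix M beta xi) q v.
Proof.
move=> rq; rewrite -(Vgram0 M Mz).
have g0 : 0 < \det (gram M Mz xi 0 q) by apply/det_spd_gt0/gram_spd_rank.
exact: derivable_Vgram.
Qed.

Lemma grad_Vfix_nu (nu : R) : nu != 0 ->
  grad (Vfix_nu M Mz beta xi nu) = grad (Vgram M Mz beta xi nu^-1).
Proof.
move=> nu0; have [c cE] := Vfix_nuE beta xi hM hMz nu0.
rewrite (funext cE); apply/funext => q; apply/matrixP => i j; rewrite !mxE.
exact: derive_cstD.
Qed.

End FixmanPotential.

Lemma eq_grad_step {R : realType} {d n : nat} (M : 'M[R]_d) (Mz : 'M[R]_n) U xi
    (dt a b : R) (W W' : 'cV[R]_d -> R) : grad W = grad W' ->
  step M Mz U xi dt a b W = step M Mz U xi dt a b W'.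
Proof. by move=> WW; rewrite /step /is_step /q_next /p_half WW. Qed.

(** * From relations to flows, and the scaling of the parameters *)

Section FlowLimit.
Context {R : realType} {d n : nat} {Q : topologicalType}.
Variables (S : Q -> state R d n -> state R d n -> Prop) (c0 : Q).
Variables (X Y : set (state R d n)).
Hypothesis oX : open X.
Hypothesis map_near : \forall c \near c0, forall x, X x ->
  exists! y, Y y /\ S c x y.
Hypothesis limit : forall (T : Type) (G : set_system T) (FG : Filter G)
  (c_ : T -> Q) (x_ y_ : T -> state R d n) x y,
  X x -> Y y -> S c0 x y -> c_ @ G --> c0 -> x_ @ G --> x ->
  (\forall t \near G, Y (y_ t) /\ S (c_ t) (x_ t) (y_ t)) -> y_ @ G --> y.
Variables (T : Type) (G : set_system T) (FG : Filter G).
Variables (S_ : T -> state R d n -> state R d n -> Prop) (c_ : T -> Q).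
Hypothesis SE : \forall t \near G, S_ t = S (c_ t).
Hypothesis cc : c_ @ G --> c0.

Lemma maps_into_limit A : maps_into A (S c0) X Y.
Proof. by move=> x Xx _; exact: nbhs_singleton map_near x Xx. Qed.

Let uniq_near : \forall t \near G, forall x, X x -> exists! y, Y y /\ S_ t x y.
Proof.
have cm : \forall t \near G, forall x, X x -> exists! y, Y y /\ S (c_ t) x y.
  exact: cc map_near.
by apply: filterS2 SE cm => t -> m x; exact: m.
Qed.

Lemma maps_into_near (A_ : T -> set (state R d n)) :
  \forall t \near G, maps_into (A_ t) (S_ t) X Y.
Proof. by apply: filterS uniq_near => t m x Xx _; exact: m. Qed.

Let flowP (r : state R d n -> state R d n -> Prop) x :
  (exists! y, Y y /\ r x y) -> Y (flow r Y x) /\ r x (flow r Y x).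
Proof.
move=> [y [Yy _]].
(* [get] satisfies the defining predicate only when some state does, hence the explicit witness. *)
exact: (@getPex _ [set y | Y y /\ r x y] (ex_intro _ y Yy)).
Qed.

Lemma flow_limit (x_ : T -> state R d n) x : X x -> x_ @ G --> x ->
  flow (S_ t) Y (x_ t) @[t --> G] --> flow (S c0) Y x.
Proof.
move=> Xx xx; have [Yy Sy] := flowP (nbhs_singleton map_near x Xx).
apply: (limit FG Xx Yy Sy cc xx).
have Xx_ : \forall t \near G, X (x_ t) by apply: xx; exact: open_nbhs_nbhs.
apply: filterS3 SE uniq_near Xx_ => t SEt m Xt.
by rewrite -SEt; exact: flowP (m _ Xt).
Qed.

End FlowLimit.

Section Scaling.
Context {R : realType} (nu : R -> R) (nubar : R).
Hypotheses (hnubar : 0 < nubar) (hnu : eps * nu eps @[eps --> 0^'+] --> nubar).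

Let eps_gt0 : \forall eps \near 0^'+, 0 < eps :> R.
Proof. exact: nbhs_right_gt. Qed.

(** The sign of [nu eps] is inherited from the limit [nubar] of [eps * nu eps], hence known for
    small [eps] only. *)
Lemma scaling_gt0 : \forall eps \near 0^'+, 0 < nu eps.
Proof.
have enu : \forall eps \near 0^'+, 0 < eps * nu eps by exact: cvgr_gt hnu _ hnubar.
by apply: filterS2 eps_gt0 enu => eps e0; rewrite pmulr_rgt0.
Qed.

Lemma cvg_scaling :
  (nu eps * eps, (nu eps)^-1) @[eps --> 0^'+] --> (nubar, 0 : R).
Proof.
have n0 : nubar != 0 by rewrite gt_eqF.
have ide : eps @[eps --> 0^'+] --> (0 : R).
  by apply: cvg_within_filter; exact: cvg_id.
have c1 : nu eps * eps @[eps --> 0^'+] --> nubar.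
  by under eq_fun do rewrite mulrC.
have c2 : (nu eps)^-1 @[eps --> 0^'+] --> (0 : R).
  (* This product equals [(nu eps)^-1] for positive [eps], and its second factor converges because
     [nubar] is nonzero. *)
  have : eps * (eps * nu eps)^-1 @[eps --> 0^'+] --> 0 * nubar^-1.
    exact: (cvgM ide (cvgV n0 hnu)).
  rewrite mul0r; apply: cvg_trans; apply: near_eq_cvg.
  apply: filterS eps_gt0 => eps e0.
  by rewrite invfM mulrA divff ?mul1r// gt_eqF.
exact: (cvg_pair c1 c2).
Qed.

End Scaling.

Theorem proposition6p8 (R : realType) (d n : nat)
    (M : 'M[R]_d) (Mz : 'M[R]_n) (beta dt nubar : R)
    (U : 'cV[R]_d -> 'cV[R]_n -> R) (xi : 'cV[R]_d -> 'cV[R]_n)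
    (nu : R -> R)
    (hM : spd M) (hMz : spd Mz) (hbeta : 0 < beta) (hdt : 0 < dt)
    (hnubar : 0 < nubar)
    (hU : smooth (fun w : 'cV[R]_d * 'cV[R]_n => U w.1 w.2))
    (hxi : smooth xi)
    (hnondeg : forall q, xi q = 0 -> \forall q' \near q, \rank (nabla xi q') = n)
    (hnu : eps * nu eps @[eps --> 0^'+] --> nubar) :
  let adm_eps eps := admissible M Mz xi (nu eps)^-1 in
  let adm_bar := admissible M Mz xi 0 in
  let step_eps eps := step M Mz U xi dt (nu eps * eps) (nu eps)^-1
                        (Vfix_nu M Mz beta xi (nu eps)) in
  let step_bar := step M Mz U xi dt nubar 0 (Vfix M beta xi) in
  let H_IMMP eps := hamiltonian M Mz U (nu eps * eps)
                      (Vfix_nu M Mz beta xi (nu eps)) in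
  let H_eff := hamiltonian M Mz U nubar (Vfix M beta xi) in
  [/\ (* the schemes are the constrained Verlet integrators of H_IMMP, H_eff *)
      \forall eps \near 0^'+, forall x y,
        step_eps eps x y <->
        constrained_verlet dt (H_IMMP eps)
          (fun q z => xi q - (nu eps)^-1 *: z) x y,
      forall x y, adm_bar x ->
        (step_bar x y <-> constrained_verlet dt H_eff (fun q _ => xi q) x y)
    & (* local convergence of the flows *)
      forall x0 y0 : state R d n, adm_bar x0 ->
      wellposed_step M Mz U xi dt nubar 0 (Vfix M beta xi) x0 y0 ->
      exists X Y : set (state R d n),
        [/\ open_nbhs x0 X /\ open_nbhs y0 Y,
            maps_into adm_bar step_bar X Y,
            \forall eps \near 0^'+, maps_into (adm_eps eps) (step_eps eps) X Y
          & forall (x : state R d n) (x_ : R -> state R d n),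
              X x -> adm_bar x ->
              (\forall eps \near 0^'+, adm_eps eps (x_ eps)) ->
              x_ eps @[eps --> 0^'+] --> x ->
              flow (step_eps eps) Y (x_ eps) @[eps --> 0^'+]
                --> flow step_bar Y x]].
Proof.
move=> adm_eps adm_bar step_eps step_bar H_IMMP H_eff.
have rank0 q : xi q = 0 -> \rank (nabla xi q) = n.
  by move=> /hnondeg; exact: nbhs_singleton.
have nu_gt0 := scaling_gt0 hnubar hnu.
pose S := step_rel M Mz beta dt U xi.
pose c_ eps := (nu eps * eps, (nu eps)^-1).
have step_epsE eps : 0 < nu eps -> step_eps eps = S (c_ eps).
  by move=> nu0; apply: eq_grad_step; apply: grad_Vfix_nu => //; rewrite gt_eqF.
have step_barE : step_bar = S (nubar, 0).
  by rewrite /S /step_rel/= Vgram0.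
have cc : c_ @ 0^'+ --> (nubar, 0 : R) by exact: cvg_scaling.
split.
- apply: filterS nu_gt0 => eps nu0 x y.
  have nun0 : nu eps != 0 by rewrite gt_eqF.
  have dW q v : derivable (Vfix_nu M Mz beta xi (nu eps)) q v.
    exact: derivable_Vfix_nu.
  exact: (step_constrained_verlet dt _ hM hMz hU (dW _) (fun _ => dW _)).
- move=> x y [xq _]; rewrite scale0r in xq.
  have dV q : xi q = 0 -> forall v, derivable (Vfix M beta xi) q v.
    by move=> q0 v; exact: (derivable_Vfix hM hMz hxi (rank0 q q0)).
  (* Writes the limit constraint as the member [b = 0] of the family [xi q - b *: z]. *)
  have -> : (fun (q : 'cV[R]_d) (_ : 'cV[R]_n) => xi q)
      = (fun q z => xi q - 0 *: z).
    by apply/funext => q; apply/funext => z; rewrite scale0r subr0.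
  have dVy : xi (posq y) = 0 *: posz y ->
      forall v, derivable (Vfix M beta xi) (posq y) v.
    by move=> yq; apply: dV; rewrite yq scale0r.
  exact: (step_constrained_verlet dt _ hM hMz hU (dV _ xq) dVy).
- move=> x0 y0 [x0q _] [l0 [m0 [step0 uA]]]; rewrite scale0r in x0q.
  (* The step also ends on the slow manifold, so [xi] has full rank at both ends. *)
  have [_ _ _ _ [y0q _]] := step0; rewrite scale0r in y0q.
  have rx0 := rank0 _ x0q; have ry0 := rank0 _ y0q.
  have nb0 : nubar != 0 by rewrite gt_eqF.
  rewrite -(Vgram0 M Mz) in step0 uA.
  have [X [Y [oX oY map_near flow_cvg]]] :=
    @local_flow R d n M Mz beta dt U xi hM hMz hdt hU hxi (nubar, 0) x0 y0
      nb0 erefl rx0 ry0 l0 m0 step0 uA.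
  have SE : \forall eps \near 0^'+, step_eps eps = S (c_ eps).
    by apply: filterS nu_gt0 => eps; exact: step_epsE.
  exists X, Y; rewrite step_barE; split; first by split.
  - exact: maps_into_limit map_near _.
  - exact: (maps_into_near map_near _ SE cc).
  - move=> x x_ Xx _ _ xx.
    exact: (flow_limit oX.1 map_near flow_cvg _ SE cc Xx xx).
Qed.
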